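(* Let $\mathbb{T}$ be a time scale, $a,b\in\mathbb{T}$ with $a<b$, $[a,b]=\{t\in\mathbb{T}:a\le t\le b\}$, and let $q:[a,b]\to\mathbb{R}$ be a continuous function. Let $\lambda_1$ be the first eigenvalue of the Sturm-Liouville problem $$y^{\Delta^2}(t)+q(t)y^\sigma(t)+\lambda y^\sigma(t)=0,\quad t\in[a,b]^{\kappa^2},\qquad y(a)=y(b)=0,$$ and let $y_1$ be a corresponding eigenfunction normalized so that $\int_a^b (y_1^\sigma)^2(t)\,\Delta t=1$. Then, among all functions $y\in C^2_{\mathrm{rd}}$ satisfying $y(a)=y(b)=0$ and $\int_a^b (y^\sigma)^2(t)\,\Delta t=1$, the functional $$J(y)=\int_a^b\left((y^\Delta)^2(t)-q(t)(y^\sigma)^2(t)\right)\Delta t$$ has a minimum at $y_1$. Moreover, $J(y_1)=\lambda_1$.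
   Context: A time scale $\mathbb{T}$ is a nonempty closed subset of $\mathbb{R}$. The forward jump operator is $\sigma(t)=\inf\{s\in\mathbb{T}:s>t\}$ and the backward jump operator is $\rho(t)=\sup\{s\in\mathbb{T}:s<t\}$, with $\inf\emptyset=\sup\mathbb{T}$ and $\sup\emptyset=\inf\mathbb{T}$. A point $t$ is right-dense if $\sigma(t)=t$ and left-dense if $\rho(t)=t$. The interval $[a,b]=\{t\in\mathbb{T}:a\le t\le b\}$ is itself regarded as a time scale; $[a,b]^\kappa=[a,b]\setminus(\rho(b),b]$ and $[a,b]^{\kappa^2}=([a,b]^\kappa)^\kappa$ (for a time scale with maximum $M$, the operation $\kappa$ removes $(\rho(M),M]$, where $\rho$ is computed in that time scale). A function $f$ on a time scale $\mathbb{T}$ is delta differentiable at $t\in\mathbb{T}^\kappa$ if there is a number $f^\Delta(t)$ (the delta derivative) such that for all $\varepsilon>0$ there is $\delta>0$ with $|f(\sigma(t))-f(s)-f^\Delta(t)(\sigma(t)-s)|\le\varepsilon|\sigma(t)-s|$ for all $s\in(t-\delta,t+\delta)\cap\mathbb{T}$. We write $f^\sigma=f\circ\sigma$ and $y^{\Delta^2}=(y^\Delta)^\Delta$. A function is rd-continuous if it is continuous at right-dense points and its left-sided limit exists at left-dense points. $C^2_{\mathrm{rd}}$ is the set of functions $y:[a,b]\to\mathbb{R}$ that are twice delta differentiable with rd-continuous second delta derivative (on $[a,b]^{\kappa^2}$). Every rd-continuous function $f$ has an antiderivative $F$ ($F^\Delta=f$), and the delta integral is $\int_a^b f(t)\,\Delta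 t=F(b)-F(a)$. The eigenvalues of the Sturm-Liouville problem are the values of $\lambda$ for which the equation has a nontrivial solution $y:[a,b]\to\mathbb{R}$ satisfying $y(a)=y(b)=0$; the corresponding nontrivial solutions are called eigenfunctions. It is known (Agarwal, Bohner and Wong) that the eigenvalues may be arranged as $-\infty<\lambda_1<\lambda_2<\cdots$; the least one, $\lambda_1$, is called the first eigenvalue.
   Formalization: In the equation, y^σ uses the jump operator of [a,b]^κ instead of [a,b]; they differ only at ρ(b) when b is left-scattered and ρ(b) left-dense, where the literal equation is overdetermined and the minimum claim can fail (e.g. on [0,1]∪{2}). *)

(* Defs.v *)
From HB Require Import structures.
From mathcomp Require Import all_boot all_order all_algebra.
From mathcomp Require Import all_classical all_reals all_analysis.
Set Implicit Arguments.
Unset Strict Implicit.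
Unset Printing Implicit Defensive.
Import Order.TTheory GRing.Theory Num.Theory.
Import numFieldNormedType.Exports.
Local Open Scope classical_set_scope.
Local Open Scope ring_scope.

(* A function on a time scale S : set R is represented by a total function
   R -> R; every notion below depends only on its values on the relevant
   subset of S. *)

Definition time_scale (R : realType) (S : set R) : Prop :=
  closed S /\ S !=set0.

(* The "else" branches are the conventions inf set0 = sup S, sup set0 = inf S
   (in the library, inf set0 = sup set0 = 0). *)
Definition sigma (R : realType) (S : set R) (t : R) : R :=
  if `[< exists s, S s /\ t < s >] then inf [set s | S s /\ t < s] else sup S.

Definition rho (R : realType) (S : set R) (t : R) : R :=
  if `[< exists s, S s /\ s < t >] then sup [set s | S s /\ s < t] else inf S.

Definition right_dense (R : realType) (S : set R) (t : R) : Prop :=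
  sigma S t = t.

Definition left_dense (R : realType) (S : set R) (t : R) : Prop :=
  rho S t = t.

Definition ts_itv (R : realType) (T : set R) (a b : R) : set R :=
  [set t | T t /\ a <= t <= b].

(* For time scales with a maximum, which is then sup S. *)
Definition kappa (R : realType) (S : set R) : set R :=
  S `\` [set t | rho S (sup S) < t <= sup S].

Definition is_delta_deriv (R : realType) (S : set R) (f : R -> R) (t d : R)
    : Prop :=
  forall e : R, 0 < e -> exists2 r : R, 0 < r &
    forall s, S s -> t - r < s < t + r ->
      `|f (sigma S t) - f s - d * (sigma S t - s)| <= e * `|sigma S t - s|.

Definition delta_derivable (R : realType) (S : set R) (f : R -> R) (t : R)
    : Prop :=
  exists d, is_delta_deriv S f t d.

Definition delta_deriv (R : realType) (S : set R) (f : R -> R) (t : R) : R :=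
  xget 0 [set d | is_delta_deriv S f t d].

(* y^Delta is a function on the time scale kappa S, so its delta derivative is
   taken in kappa S, on (kappa S)^kappa. *)
Definition delta_deriv2 (R : realType) (S : set R) (y : R -> R) : R -> R :=
  delta_deriv (kappa S) (delta_deriv S y).

Definition twice_delta_derivable (R : realType) (S : set R) (y : R -> R)
    : Prop :=
  (forall t, kappa S t -> delta_derivable S y t) /\
  (forall t, kappa (kappa S) t ->
     delta_derivable (kappa S) (delta_deriv S y) t).

(* f is a function on the subset D of the time scale S; right- and left-dense
   are meant in S.  (A point of D may be right-scattered in S and yet be the
   maximum of D, hence right-dense in D.) *)
Definition rd_continuous_on (R : realType) (S D : set R) (f : R -> R) : Prop :=
  (forall t, D t -> right_dense S t -> f s @[s --> within D (nbhs t)] --> f t) /\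
  (forall t, D t -> left_dense S t ->
     exists l : R, f s @[s --> within (D `&` [set s | s < t]) (nbhs t)] --> l).

Definition C2rd (R : realType) (S : set R) (y : R -> R) : Prop :=
  twice_delta_derivable S y /\
  rd_continuous_on S (kappa (kappa S)) (delta_deriv2 S y).

Definition antiderivative (R : realType) (S : set R) (f F : R -> R) : Prop :=
  forall t, kappa S t -> is_delta_deriv S F t (f t).

Definition delta_integral (R : realType) (S : set R) (a b : R) (f : R -> R)
    : R :=
  xget 0 [set v | exists2 F, antiderivative S f F & v = F b - F a].

(* The shift y^sigma in the equation is taken in kappa S, the time scale in
   which y^{Delta^2} is computed.  On (kappa S)^kappa the jump operators of
   kappa S and S agree except at m = rho(b) when b = max S is left-scattered
   and m is left-dense.  There y^{Delta^2}(m) is the left derivative of y^Delta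
   and equals the limit of -(q + lambda) y^sigma at m, which is
   -(q(m) + lambda) y(m); imposing -(q(m) + lambda) y(b) = 0 instead would make
   the problem overdetermined and leave at most the eigenvalue -q(m). *)
Definition SL_solution (R : realType) (S : set R) (q : R -> R) (lambda : R)
    (y : R -> R) : Prop :=
  twice_delta_derivable S y /\
  forall t, kappa (kappa S) t ->
    delta_deriv2 S y t + q t * y (sigma (kappa S) t)
      + lambda * y (sigma (kappa S) t) = 0.

Definition sl_eigenfunction (R : realType) (S : set R) (a b : R) (q : R -> R)
    (lambda : R) (y : R -> R) : Prop :=
  [/\ SL_solution S q lambda y, y a = 0, y b = 0 &
      exists t, S t /\ y t <> 0].

Definition sl_eigenvalue (R : realType) (S : set R) (a b : R) (q : R -> R)
    (lambda : R) : Prop :=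
  exists y, sl_eigenfunction S a b q lambda y.

Definition first_eigenvalue (R : realType) (S : set R) (a b : R) (q : R -> R)
    (lambda : R) : Prop :=
  sl_eigenvalue S a b q lambda /\
  forall mu, sl_eigenvalue S a b q mu -> lambda <= mu.

Definition normalized (R : realType) (S : set R) (a b : R) (y : R -> R)
    : Prop :=
  delta_integral S a b (fun t => y (sigma S t) ^+ 2) = 1.

Definition admissible (R : realType) (S : set R) (a b : R) (y : R -> R)
    : Prop :=
  [/\ C2rd S y, y a = 0, y b = 0 & normalized S a b y].

Definition J (R : realType) (S : set R) (a b : R) (q y : R -> R) : R :=
  delta_integral S a b
    (fun t => delta_deriv S y t ^+ 2 - q t * y (sigma S t) ^+ 2).

(* Main.v *)
Require Import Defs.
From HB Require Import structures.
From mathcomp Require Import all_boot all_order all_algebra.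
From mathcomp Require Import all_classical all_reals all_analysis.
From mathcomp Require Import ring lra.
Set Implicit Arguments.
Unset Strict Implicit.
Unset Printing Implicit Defensive.
Import Order.TTheory GRing.Theory Num.Theory.
Import numFieldNormedType.Exports.
Local Open Scope classical_set_scope.
Local Open Scope ring_scope.

(** Write [S] for the time scale between [a] and [b], [K] for [kappa S], and call
    energy at [lambda] of [y] the integral of
    [(y^Delta)^2 - (q + lambda) (y^sigma)^2]. The theorem says that the energy at
    [lambda1] vanishes at the eigenfunction and is nonnegative at every [y] that
    vanishes at both ends.

    The equality is integration by parts: [y y^Delta] is an antiderivative of the
    integrand when [y] solves the equation ([energy_eigen]).

    For the inequality, suppose that at some [lambda] there is a solution [u]
    that is positive on all of [S]. Picone's identity writes the integrand as the
    derivative of [y^2 u^Delta / u] plus a square divided by [u u^sigma], so the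
    energy at [lambda] is nonnegative ([energy_picone]). Consider now the
    solution that starts at [a] with value [0] and slope [1], and the set of
    those [lambda] for which it is positive to the right of [a]. For such a
    [lambda], lifting the initial value slightly above [0] gives a solution that
    is positive everywhere ([positive_stable]); hence the energy inequality holds
    on this set and, by a limit, at its supremum. The set contains every very
    negative [lambda] ([dirichlet_positive_exists]) and is bounded by [lambda1],
    where the energy of the eigenfunction vanishes. It is open, so at its
    supremum the solution is only nonnegative and has a zero to the right of [a].
    An interior zero of a nonnegative solution would be a zero of its slope too,
    against the constancy of the Wronskian ([no_interior_zero]); the zero
    therefore lies at [b], the supremum is an eigenvalue
    ([dirichlet_positive_sup]), and it is at least [lambda1] since [lambda1] is
    the first one.

    Two analytic tools support this. Antiderivatives are upper Darboux integrals,
    characterized by minimality ([upper_integral]). Solutions of initial value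
    problems are limits of Picard iterates; a norm with an exponential weight
    makes the iteration a contraction, and the same estimate controls the
    dependence on [lambda] and on the initial value ([weighted_contraction]).

    The right end of [S] needs care. When [b] is isolated, the equation lives on
    [K], whose maximum [m] is followed by a gap. Identities are therefore proved
    on [K] below [m], where the jump operators of [K] and [S] agree, and the gap
    from [m] to [b] is treated by a direct computation ([last_gap]). *)

(** * Limits within a set *)

Lemma cvg_withinP (R : realType) (A : set R) (f : R -> R) (t l : R) :
  f s @[s --> within A (nbhs t)] --> l <->
  forall e, 0 < e -> exists2 r, 0 < r &
    forall s, A s -> `|s - t| < r -> `|f s - l| <= e.
Proof.
split=> [/cvgrPdist_le fl e e0|fl].
- have := fl e e0; rewrite near_withinE => /nbhs_ballP[r /= r0 rP].
  exists r => // s As st; rewrite distrC; apply: rP => //.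
  by rewrite /ball /= distrC.
- apply/cvgrPdist_le => e e0; have [r r0 rP] := fl e e0.
  rewrite near_withinE; apply/nbhs_ballP; exists r => //= s st As.
  by rewrite distrC; apply: rP => //; rewrite distrC.
Qed.

Lemma cvg_within_self (R : realType) (A : set R) (f : R -> R) (t l : R) :
  A t -> f s @[s --> within A (nbhs t)] --> l -> f t = l.
Proof.
move=> At /cvg_withinP fl; apply/eqP; rewrite -subr_eq0 -normr_le0.
apply/ler_addgt0Pl => e e0; have [r r0 /(_ t At)] := fl e e0.
by rewrite subrr normr0 addr0 => /(_ r0).
Qed.

Lemma cvg_withinS (R : realType) (A B : set R) (f : R -> R) (t l : R) :
  B `<=` A -> f s @[s --> within A (nbhs t)] --> l ->
  f s @[s --> within B (nbhs t)] --> l.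
Proof.
move=> BA /cvg_withinP fl; apply/cvg_withinP => e /fl[r r0 rP].
by exists r => // s Bs; apply: rP; exact: BA.
Qed.

(** * The jump operators of a compact time scale *)

Definition compact_ts (R : realType) (S : set R) (a b : R) : Prop :=
  [/\ closed S, S a, S b & forall t, S t -> a <= t <= b].

Lemma compact_ts_itv (R : realType) (T : set R) (a b : R) :
  closed T -> T a -> T b -> a <= b -> compact_ts (ts_itv T a b) a b.
Proof.
move=> cT Ta Tb ab; split.
- rewrite (_ : ts_itv T a b = T `&` [set` `[a, b]]).
    by apply: closedI => //; exact: interval_closed.
  by apply/seteqP; split=> t; rewrite /ts_itv /= in_itv.
- by split=> //; rewrite lexx.
- by split=> //; rewrite lexx andbT.
- by move=> t [].
Qed.

Lemma closed_adherent (R : realType) (S : set R) (t : R) : closed S ->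
  (forall e, 0 < e -> exists2 s, S s & `|s - t| < e) -> S t.
Proof.
move=> cS adh; apply: cS => U /nbhs_ballP[e /= e0 eU].
have [s Ss st] := adh e e0; exists s; split => //; apply: eU.
by rewrite /ball /= distrC.
Qed.

Lemma compact_ts_compact (R : realType) (S : set R) (a b : R) :
  compact_ts S a b -> compact S.
Proof.
move=> [cS _ _ Sab]; apply: (subclosed_compact cS (@segment_compact R a b)).
by move=> t /Sab; rewrite /= in_itv.
Qed.

Lemma sup_compact_ts (R : realType) (S : set R) (a b : R) :
  compact_ts S a b -> sup S = b.
Proof.
move=> [cS Sa Sb Sab]; have ubS : ubound S b by move=> t /Sab/andP[].
apply/eqP; rewrite eq_le; apply/andP; split.
  by apply: ge_sup => //; exists b.
by apply: ub_le_sup => //; exists b.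
Qed.

(** The point [m] is the maximum of [kappa S]. By [kappa_ts_last], either [b] is
    left-dense and [kappa S] is all of [S], or [b] is isolated and a gap leads
    from [m] to [b]. *)
Record kappa_ts (R : realType) (S : set R) (a b m : R) : Prop := KappaTs {
  kappa_ts_base : compact_ts S a b;
  kappa_ts_kappa : compact_ts (kappa S) a m;
  kappa_tsP : forall t, kappa S t <-> S t /\ t <= m;
  kappa_ts_max : forall t, S t -> t < b -> t <= m;
  kappa_ts_last :
    (m = b /\ forall e, 0 < e -> exists s, [/\ S s, s < b & b - e < s]) \/ m < b
}.

Section jump.
Variables (R : realType) (S : set R) (a b : R).
Hypothesis tsS : compact_ts S a b.
Let cS : closed S. Proof. by case: tsS. Qed.
Let Sb : S b. Proof. by case: tsS. Qed.
Let Sa : S a. Proof. by case: tsS. Qed.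
Let Sle t : S t -> t <= b. Proof. by case: tsS => _ _ _ /[apply] /andP[]. Qed.
Let Sge t : S t -> a <= t. Proof. by case: tsS => _ _ _ /[apply] /andP[]. Qed.

Lemma sigma_max : sigma S b = b.
Proof.
rewrite /sigma; case: asboolP => [[s [/Sle sb bs]]|_].
  by have := lt_le_trans bs sb; rewrite ltxx.
exact: sup_compact_ts tsS.
Qed.

Lemma sigmaE t : t < b -> sigma S t = inf [set s | S s /\ t < s].
Proof. by move=> tb; rewrite /sigma asboolT//; exists b. Qed.

Let has_inf_above t : t < b -> has_inf [set s | S s /\ t < s].
Proof. by move=> tb; split; [exists b|exists t => s [_ /ltW]]. Qed.

Lemma sigma_le t s : S s -> t < s -> sigma S t <= s.
Proof.
move=> Ss ts; have tb := lt_le_trans ts (Sle Ss).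
by rewrite sigmaE//; apply: ge_inf => //; have [] := has_inf_above tb.
Qed.

Lemma sigma_ge t : t <= b -> t <= sigma S t.
Proof.
rewrite le_eqVlt => /predU1P[->|tb]; first by rewrite sigma_max.
by rewrite sigmaE//; apply: lb_le_inf => [|s [_ /ltW]//]; exists b.
Qed.

Lemma sigma_adherent t e : t < b -> 0 < e ->
  exists s, [/\ S s, t < s & s < sigma S t + e].
Proof.
move=> tb e0; rewrite sigmaE//.
by have [s [Ss ts] se] := inf_adherent e0 (has_inf_above tb); exists s.
Qed.

Lemma sigma_in t : t <= b -> S (sigma S t).
Proof.
rewrite le_eqVlt => /predU1P[->|tb]; first by rewrite sigma_max.
apply: closed_adherent => // e e0.
have [s [Ss ts se]] := sigma_adherent tb e0; exists s => //.
by rewrite ger0_norm ?subr_ge0 ?sigma_le// ltrBlDl.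
Qed.

(** Left of a point [t] the jump operator is squeezed between the identity and
    [t]; right of a right-dense [t], the points that witness right-density
    squeeze it. *)
Lemma sigma_cvg t : S t -> sigma S t = t ->
  sigma S s @[s --> within S (nbhs t)] --> t.
Proof.
move=> St tt; apply/cvg_withinP => e e0.
have sl s : S s -> s < t -> `|s - t| < e -> `|sigma S s - t| <= e.
  move=> Ss st; have := sigma_le St st; have := sigma_ge (Sle Ss).
  by rewrite ltr_norml ler_norml => ? ? /andP[? ?]; apply/andP; split; lra.
have := Sle St; rewrite le_eqVlt => /predU1P[tb|tb].
  exists e => // s Ss ste; have := Sle Ss; rewrite le_eqVlt => /predU1P[->|sb].
    by rewrite sigma_max tb subrr normr0 ltW.
  by apply: sl => //; rewrite tb.
have [u [Su tu ue]] := sigma_adherent tb e0; rewrite tt in ue.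
exists (Num.min e (u - t)); first by rewrite lt_min e0 subr_gt0.
move=> s Ss; rewrite lt_min => /andP[se su].
have [st|ts] := ltP s t; first exact: sl.
have su' : s < u by move: su; rewrite ltr_norml => /andP[_]; lra.
have := sigma_le Su su'; have := sigma_ge (Sle Ss).
by rewrite ler_norml => ? ?; apply/andP; split; lra.
Qed.

Lemma sigma_cvg_left t : S t ->
  sigma S s @[s --> within (S `&` [set s | s < t]) (nbhs t)] --> t.
Proof.
move=> St; apply/cvg_withinP => e e0; exists e => // s [Ss /= st] ste.
have := sigma_le St st; have := sigma_ge (Sle Ss); move: ste.
by rewrite ltr_norml ler_norml => /andP[? ?] ? ?; apply/andP; split; lra.
Qed.

Lemma kappa_ts_exists : a < b -> exists m, kappa_ts S a b m.
Proof.
move=> ab; pose B := [set s | S s /\ s < b].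
have supB : has_sup B by split; [exists a|exists b => s [_ /ltW]].
have rhoE : rho S (sup S) = sup B.
  by rewrite (sup_compact_ts tsS) /rho asboolT//; exists a.
have Bm t : S t -> t < b -> t <= sup B.
  by move=> St tb; apply: ub_le_sup => //; exact: supB.2.
have mb : sup B <= b by apply: ge_sup => [|s [_ /ltW]//]; exists a.
have Sm : S (sup B).
  apply: closed_adherent => // e e0; have [s [Ss sb] se] := sup_adherent e0 supB.
  exists s => //; have := Bm s Ss sb; rewrite ltr_norml => ?; apply/andP; lra.
have kP t : kappa S t <-> S t /\ t <= sup B.
  rewrite /kappa rhoE (sup_compact_ts tsS); split=> -[St nt]; split=> //.
    by rewrite leNgt; apply/negP => mt; apply: nt => /=; rewrite mt Sle.
  by move=> /= /andP[]; rewrite ltNge nt.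
exists (sup B); split => //.
- split.
  + rewrite (_ : kappa S = S `&` [set` `]-oo, sup B]]).
      by apply: closedI => //; exact: interval_closed.
    by apply/seteqP; split=> t; rewrite /= in_itv/= => ?; apply/kP.
  + by apply/kP; split=> //; exact: Bm.
  + by apply/kP.
  + by move=> t /kP[St ->]; rewrite Sge.
- move: mb; rewrite le_eqVlt => /predU1P[mb|]; [left; split=> //|by right].
  move=> e e0; have [s [Ss sb]] := sup_adherent e0 supB.
  by exists s; split=> //; rewrite -mb.
Qed.

End jump.

Section kappa_ts.
Variables (R : realType) (S : set R) (a b m : R).
Hypothesis kS : kappa_ts S a b m.
Let tsS := kappa_ts_base kS.
Let tsK := kappa_ts_kappa kS.

Lemma kappa_sub : kappa S `<=` S. Proof. by move=> t []. Qed.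

Lemma kappa_ts_le t : S t -> a <= t <= b.
Proof. by case: tsS => _ _ _; apply. Qed.

Lemma kappa_in_max : kappa S m. Proof. by case: tsK. Qed.

Lemma kappa_ts_max_le : m <= b.
Proof. by have /kappa_sub/kappa_ts_le/andP[] := kappa_in_max. Qed.

Lemma kappa_lt t : S t -> t < b -> kappa S t.
Proof. by move=> St tb; apply/(kappa_tsP kS); split=> //; exact: (kappa_ts_max kS). Qed.

Lemma kappa_lt_trans s t : S s -> S t -> s < t -> kappa S s.
Proof.
by move=> Ss /kappa_ts_le/andP[_ tb] st; apply: kappa_lt => //; exact: lt_le_trans tb.
Qed.

(** The bound on [t] is sharp: at [m] the two operators differ when [m] is followed
    by a gap. *)
Lemma sigma_kappa t : t < m -> sigma (kappa S) t = sigma S t.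
Proof.
move=> tm; have mb := kappa_ts_max_le; have tb := lt_le_trans tm mb.
have Km := kappa_in_max; apply/eqP; rewrite eq_le; apply/andP; split.
- have := sigma_le tsS (kappa_sub Km) tm.
  rewrite [_ <= m]le_eqVlt => /predU1P[->|sm]; first exact: (sigma_le tsK Km tm).
  apply/ler_addgt0Pr => e e0.
  have e'0 : 0 < Num.min e (m - sigma S t) by rewrite lt_min e0 subr_gt0.
  have [s [Ss ts]] := sigma_adherent tsS tb e'0.
  rewrite -ltrBlDl lt_min => /andP[se sm'].
  have Ks : kappa S s by apply/(kappa_tsP kS); split=> //; lra.
  by have := sigma_le tsK Ks ts; lra.
- apply/ler_addgt0Pr => e e0.
  have [s [/kappa_sub Ss ts se]] := sigma_adherent tsK tm e0.
  by have := sigma_le tsS Ss ts; lra.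
Qed.

Lemma sigma_kappa_max : sigma (kappa S) m = m.
Proof. exact: (sigma_max tsK). Qed.

Lemma sigma_kappa_in t : kappa S t -> kappa S (sigma (kappa S) t).
Proof. by move=> Kt; apply: (sigma_in tsK); case: tsK => _ _ _ /(_ _ Kt)/andP[]. Qed.

Lemma sigma_last : m < b -> sigma S m = b.
Proof.
move=> mb; apply/eqP; rewrite eq_le; apply/andP; split.
  by apply: (sigma_le tsS _ mb); case: tsS.
apply/ler_addgt0Pr => e e0; have [s [Ss ms se]] := sigma_adherent tsS mb e0.
have [sb|bs] := ltP s b; last by lra.
by have := kappa_ts_max kS Ss sb; lra.
Qed.

End kappa_ts.

(** * The calculus of delta derivatives *)

(** The form of differentiability due to Caratheodory: the slope between
    [sigma S t] and [s] extends to a function of [s] with limit [d]. It turns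
    the rules of differentiation into algebra of limits. *)
Lemma delta_derivP (R : realType) (S : set R) (f : R -> R) (t d : R) :
  is_delta_deriv S f t d <->
  exists2 phi : R -> R,
    forall s, S s -> f (sigma S t) - f s = phi s * (sigma S t - s) &
    phi s @[s --> within S (nbhs t)] --> d.
Proof.
split=> [fd|[phi fphi /cvg_withinP phid] e e0].
- exists (fun s => if s == sigma S t then d
                   else (f (sigma S t) - f s) / (sigma S t - s)).
    move=> s Ss; case: eqVneq => [->|st]; first by rewrite !subrr mulr0.
    by rewrite divfK// subr_eq0 eq_sym.
  apply/cvg_withinP => e e0; have [r r0 rP] := fd e e0; exists r => //= s Ss st.
  case: eqVneq => [_|sst]; first by rewrite subrr normr0 ltW.
  have ts0 : sigma S t - s != 0 by rewrite subr_eq0 eq_sym.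
  have := rP s Ss; rewrite -ltr_distl => /(_ st) H.
  rewrite -(ler_pM2r (_ : 0 < `|sigma S t - s|)) ?normr_gt0//.
  by rewrite -normrM mulrBl divfK.
- have [r r0 rP] := phid e e0; exists r => // s Ss; rewrite -ltr_distl => st.
  by rewrite fphi// -mulrBl normrM ler_wpM2r// rP.
Qed.

Section delta_deriv_rules.
Variables (R : realType) (S : set R) (t : R).
Hypothesis St : S t.
Implicit Types (f g : R -> R) (d : R).

Let sub_sigma_cvg : sigma S t - s @[s --> within S (nbhs t)] --> sigma S t - t.
Proof.
apply/cvg_withinP => e e0; exists e => // s Ss /ltW.
by rewrite distrC; congr (`|_| <= _); ring.
Qed.

Lemma delta_deriv_jump f d :
  is_delta_deriv S f t d -> f (sigma S t) - f t = d * (sigma S t - t).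
Proof. by move=> /delta_derivP[phi fphi /(cvg_within_self St) <-]; exact: fphi. Qed.

Lemma delta_deriv_cvg f d :
  is_delta_deriv S f t d -> f s @[s --> within S (nbhs t)] --> f t.
Proof.
move=> fd; have fj := delta_deriv_jump fd.
move/delta_derivP: fd => [phi fphi phid].
have : f (sigma S t) - phi s * (sigma S t - s) @[s --> within S (nbhs t)]
       --> f (sigma S t) - d * (sigma S t - t).
  by apply: cvgB; [exact: cvg_cst|exact: (cvgM phid sub_sigma_cvg)].
have -> : f (sigma S t) - d * (sigma S t - t) = f t by rewrite -fj; ring.
move=> /cvg_withinP H; apply/cvg_withinP => e /H[r r0 rP]; exists r => // s Ss.
have -> : f s = f (sigma S t) - phi s * (sigma S t - s) by rewrite -fphi//; ring.
exact: rP.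
Qed.

Lemma delta_derivD f g d e : is_delta_deriv S f t d -> is_delta_deriv S g t e ->
  is_delta_deriv S (fun s => f s + g s) t (d + e).
Proof.
move=> /delta_derivP[phi fphi phid] /delta_derivP[psi gpsi psie].
apply/delta_derivP; exists (fun s => phi s + psi s); last exact: cvgD.
by move=> s Ss; rewrite mulrDl -fphi// -gpsi//; ring.
Qed.

Lemma delta_derivZ c f d : is_delta_deriv S f t d ->
  is_delta_deriv S (fun s => c * f s) t (c * d).
Proof.
move=> /delta_derivP[phi fphi phid].
apply/delta_derivP; exists (fun s => c * phi s).
  by move=> s Ss; rewrite -mulrA -fphi//; ring.
by apply: cvgM => //; exact: cvg_cst.
Qed.

Lemma delta_derivDcst c f d : is_delta_deriv S f t d ->
  is_delta_deriv S (fun s => c + f s) t d.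
Proof.
move=> fd e /fd[r r0 rP]; exists r => // s Ss /(rP s Ss).
by congr (`|_| <= _); ring.
Qed.

Lemma delta_derivB f g d e : is_delta_deriv S f t d -> is_delta_deriv S g t e ->
  is_delta_deriv S (fun s => f s - g s) t (d - e).
Proof.
move=> fd /(delta_derivZ (-1)); rewrite mulN1r => /(delta_derivD fd).
by under eq_fun do rewrite mulN1r.
Qed.

Lemma delta_derivM f g d e : is_delta_deriv S f t d -> is_delta_deriv S g t e ->
  is_delta_deriv S (fun s => f s * g s) t (d * g t + f (sigma S t) * e).
Proof.
move=> fd ge; have gt := delta_deriv_cvg ge.
move/delta_derivP: fd => [phi fphi phid].
move/delta_derivP: ge => [psi gpsi psie].
apply/delta_derivP; exists (fun s => phi s * g s + f (sigma S t) * psi s).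
  move=> s Ss; rewrite mulrDl -(mulrA (f _)) -gpsi// mulrAC -fphi//; ring.
by apply: cvgD; apply: cvgM => //; exact: cvg_cst.
Qed.

Lemma delta_derivV f d : (forall s, S s -> f s != 0) -> S (sigma S t) ->
  is_delta_deriv S f t d ->
  is_delta_deriv S (fun s => (f s)^-1) t (- d / (f t * f (sigma S t))).
Proof.
move=> f0 Sst fd; have ft := delta_deriv_cvg fd.
move/delta_derivP: fd => [phi fphi phid].
apply/delta_derivP; exists (fun s => - phi s / (f s * f (sigma S t))).
  move=> s Ss; rewrite mulrAC mulNr -fphi//.
  by field; rewrite !f0.
apply: cvgM; first exact: cvgN.
apply: cvgV; first by rewrite mulf_neq0// f0.
by apply: cvgM => //; exact: cvg_cst.
Qed.

Lemma delta_deriv_ext f g d : (forall s, S s -> f s = g s) -> S (sigma S t) ->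
  is_delta_deriv S f t d -> is_delta_deriv S g t d.
Proof.
move=> fg Sst fd e /fd[r r0 rP]; exists r => // s Ss.
by rewrite -!fg//; exact: rP.
Qed.

Lemma delta_deriv_sub (B : set R) f d : B `<=` S -> sigma B t = sigma S t ->
  is_delta_deriv S f t d -> is_delta_deriv B f t d.
Proof.
move=> BS Bt fd e /fd[r r0 rP]; exists r => // s /BS Ss.
by rewrite Bt; exact: rP.
Qed.

(** The comparison of increments uses only this growth of [f] just to the right of
    [t]; over a gap it is exact. *)
Lemma delta_deriv_right a b f d e : compact_ts S a b -> t < b ->
  is_delta_deriv S f t d -> 0 < e -> exists u, [/\ S u, t < u &
    forall x, S x -> t < x <= u -> `|f x - f t - d * (x - t)| <= e * (x - t)].
Proof.
move=> tsS tb fd e0; have := sigma_ge tsS (ltW tb).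
rewrite le_eqVlt => /predU1P[tt|tst].
- have [r r0 rP] := fd e e0.
  have [u [Su tu ur]] := sigma_adherent tsS tb r0; exists u; split=> // x Sx.
  move=> /andP[tx xu]; have := rP x Sx; rewrite -tt in ur *.
  have xr : t - r < x < t + r by apply/andP; split; lra.
  move=> /(_ xr); rewrite -normrN (distrC t x) (gtr0_norm (_ : 0 < x - t)) ?subr_gt0//.
  by congr (`|_| <= _); ring.
- exists (sigma S t); split=> //; first exact: (sigma_in tsS (ltW tb)).
  move=> x Sx /andP[tx xs].
  have -> : x = sigma S t by apply/eqP; rewrite eq_le xs (sigma_le tsS Sx tx).
  by rewrite (delta_deriv_jump fd) subrr normr0 mulr_ge0// ?subr_ge0 ltW.
Qed.

End delta_deriv_rules.

(** Every point of [kappa S] is a limit of points [s] of [S] other than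
    [sigma S t], and those determine the slope. This fails on a one-point time
    scale, whence [a < b]. *)
Lemma delta_deriv_uniq (R : realType) (S : set R) (a b m : R) (f : R -> R)
    (t d e : R) : kappa_ts S a b m -> a < b -> kappa S t ->
  is_delta_deriv S f t d -> is_delta_deriv S f t e -> d = e.
Proof.
move=> kS ab Kt fd fe; have St := kappa_sub Kt.
have tsS := kappa_ts_base kS; have /andP[ta tb] := kappa_ts_le kS St.
have [tst|tst] := eqVneq (sigma S t) t; last first.
  have := delta_deriv_jump St fd; rewrite (delta_deriv_jump St fe).
  by move=> /mulIf; rewrite subr_eq0 => /(_ tst).
apply/eqP; rewrite -subr_eq0 -normr_le0; apply/ler_addgt0Pl => h h0.
have h20 : 0 < h / 2 by lra.
have [r r0 rP] := fd _ h20; have [r' r'0 rP'] := fe _ h20.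
have rr0 : 0 < Num.min r r' by rewrite lt_min r0.
have [s [Ss st sr]] : exists s, [/\ S s, s != t & `|s - t| < Num.min r r'].
  move: tb; rewrite le_eqVlt => /predU1P[tb|tb].
    case: (kappa_ts_last kS) => [[mb /(_ _ rr0)[s [Ss sb sr]]]|mb].
      by exists s; split; rewrite // tb ?lt_eqF// ltr0_norm ?subr_lt0//; lra.
    by move/(kappa_tsP kS): Kt => [_]; rewrite tb leNgt mb.
  have [s [Ss ts sr]] := sigma_adherent tsS tb rr0; exists s; split=> //.
    by rewrite gt_eqF.
  by rewrite gtr0_norm ?subr_gt0// ltrBlDl -{1}tst.
move: sr; rewrite lt_min => /andP[sr sr'].
have := rP s Ss; rewrite -ltr_distl => /(_ sr).
have := rP' s Ss; rewrite -ltr_distl => /(_ sr') H1 H2.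
have st0 : 0 < `|sigma S t - s| by rewrite normr_gt0 subr_eq0 tst eq_sym.
rewrite addr0 -(ler_pM2r st0) -normrM.
have -> : (d - e) * (sigma S t - s) = (f (sigma S t) - f s - e * (sigma S t - s))
   - (f (sigma S t) - f s - d * (sigma S t - s)) by ring.
by apply: le_trans (ler_normB _ _) _; lra.
Qed.

Definition cont_on (R : realType) (S : set R) (f : R -> R) : Prop :=
  forall t, S t -> f s @[s --> within S (nbhs t)] --> f t.

Lemma cont_on_isolated (R : realType) (S : set R) (a b m : R) (f : R -> R) :
  kappa_ts S a b m -> m < b -> f s @[s --> within S (nbhs b)] --> f b.
Proof.
move=> kS mb; apply/cvg_withinP => e e0; exists (b - m); first by rewrite subr_gt0.
move=> s Ss sb; have /andP[_] := kappa_ts_le kS Ss.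
rewrite le_eqVlt => /predU1P[->|sb']; first by rewrite subrr normr0 ltW.
by have := kappa_ts_max kS Ss sb'; move: sb; rewrite ltr0_norm ?subr_lt0//; lra.
Qed.

Lemma delta_deriv_cont_on (R : realType) (S : set R) (a b m : R)
    (f d : R -> R) : kappa_ts S a b m ->
  (forall t, kappa S t -> is_delta_deriv S f t (d t)) -> cont_on S f.
Proof.
move=> kS fd t St; have /andP[_] := kappa_ts_le kS St.
rewrite le_eqVlt => /predU1P[->|tb]; last first.
  by apply: (delta_deriv_cvg St (fd t _)); exact: (kappa_lt kS).
case: (kappa_ts_last kS) => [[mb _]|mb]; last exact: (cont_on_isolated kS mb).
have Kb : kappa S b by rewrite -mb; case: (kappa_ts_kappa kS).
exact: (delta_deriv_cvg (kappa_sub Kb) (fd b Kb)).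
Qed.

Lemma cont_on_bounded (R : realType) (S : set R) (a b : R) (f : R -> R) :
  compact_ts S a b -> cont_on S f ->
  exists2 B, 0 < B & forall t, S t -> `|f t| <= B.
Proof.
move=> tsS /subspace_continuousP fS.
have cS : compact (f @` S) by apply: continuous_compact => //; exact: (compact_ts_compact tsS).
have [M [_ MP]] := compact_bounded cS; have M1 : M < `|M| + 1.
  by rewrite (le_lt_trans (ler_norm M))// ltrDl.
exists (`|M| + 1); first by rewrite ltr_wpDl.
by move=> t St; apply: (MP _ M1); exists t.
Qed.

(** * Comparison of increments *)

(** Continuous induction along [S]: for each slack [e] the set of points up to
    which [F] has lost at most [e] per unit of length has a supremum, to which
    continuity carries the bound and beyond which the growth condition extends
    it. *)
Lemma increments_ge0 (R : realType) (S : set R) (F : R -> R) (s0 t0 : R) :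
  closed S -> S s0 -> S t0 -> s0 <= t0 ->
  (forall t, S t -> s0 < t <= t0 -> F s @[s --> within S (nbhs t)] --> F t) ->
  (forall u e, S u -> s0 <= u < t0 -> 0 < e -> exists u', [/\ S u', u < u' &
    forall x, S x -> u < x <= u' -> - e * (x - u) <= F x - F u]) ->
  F s0 <= F t0.
Proof.
move=> cS Ss0 St0 st0 Fc Fr; apply/ler_addgt0Pr => h h0.
pose e := h / (t0 - s0 + 1); have d0 : 0 < t0 - s0 + 1 by lra.
have e0 : 0 < e by rewrite divr_gt0.
pose A := [set t | [/\ S t, s0 <= t, t <= t0 & forall u, S u -> s0 <= u <= t ->
                    F s0 - e * (u - s0) <= F u]].
have As0 : A s0.
  split=> // u _; rewrite -eq_le => /eqP <-; lra.
have supA : has_sup A by split; [exists s0|exists t0 => t []].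
pose tau := sup A.
have tau_ge t : A t -> t <= tau by move=> At; apply: ub_le_sup => //; exact: supA.2.
have tau_le : tau <= t0 by apply: ge_sup => [|t []//]; exists s0.
have s0tau := tau_ge _ As0.
have Stau : S tau.
  apply: closed_adherent => // r r0; have [t At] := sup_adherent r0 supA; rewrite -/tau => tr.
  exists t; first by case: At.
  by have := tau_ge _ At; rewrite ltr_norml => ?; apply/andP; split; lra.
have lttau u : S u -> s0 <= u < tau -> F s0 - e * (u - s0) <= F u.
  move=> Su /andP[su ut]; have ut0 : 0 < tau - u by lra.
  have [t [_ _ _ AtP]] := sup_adherent ut0 supA; rewrite -/tau => tr.
  by apply: AtP => //; rewrite su/=; lra.
have Ftau : F s0 - e * (tau - s0) <= F tau.
  move: s0tau; rewrite [s0 <= _]le_eqVlt => /predU1P[<-|s0t]; first lra.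
  have [//|lt] := leP (F s0 - e * (tau - s0)) (F tau).
  pose g := F s0 - e * (tau - s0) - F tau; have g0 : 0 < g / 2 by rewrite /g; lra.
  have tau0 : s0 < tau <= t0 by rewrite s0t.
  have /cvg_withinP/(_ _ g0)[r r0 rP] := Fc tau Stau tau0.
  have [t At] := sup_adherent r0 supA; rewrite -/tau => tr.
  have := tau_ge _ At; rewrite [t <= _]le_eqVlt => /predU1P[tt|tt].
    by case: At => _ _ _ /(_ tau Stau); rewrite tt (ltW s0t) lexx leNgt lt => /(_ isT).
  case: At => St s0t' _ _; have := lttau t St; rewrite s0t' tt => /(_ isT).
  have := rP t St; rewrite ltr0_norm ?subr_lt0// opprB.
  have tr' : tau - t < r by lra.
  move=> /(_ tr'); rewrite ler_norml => /andP[_].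
  have : 0 <= e * (tau - t) by rewrite mulr_ge0 ?ltW// subr_gt0.
  rewrite /g mulrBr; lra.
have Atau : A tau.
  split=> // u Su /andP[su]; rewrite [u <= _]le_eqVlt => /predU1P[->//|ut].
  by apply: lttau => //; rewrite su.
move: tau_le; rewrite [tau <= _]le_eqVlt => /predU1P[tt|tt].
  rewrite -tt; apply: le_trans (_ : F tau + e * (tau - s0) <= _); first lra.
  rewrite lerD2l tt /e mulrAC ler_pdivrMr// ler_pM2l//; lra.
have tau1 : s0 <= tau < t0 by rewrite s0tau.
have [u' [Su' tu' u'P]] := Fr tau e Stau tau1 e0.
suff /tau_ge : A (Num.min u' t0) by rewrite ge_min !leNgt tt tu'.
have Smin : S (Num.min u' t0) by case: leP.
split=> //; first by rewrite le_min (ltW (le_lt_trans s0tau tu')) st0.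
  by rewrite ge_min lexx orbT.
move=> u Su /andP[su]; rewrite le_min => /andP[uu' ut0].
have [utau|tauu] := leP u tau; first by case: Atau => _ _ _; apply=> //; rewrite su.
by have := u'P u Su; rewrite tauu uu' => /(_ isT); rewrite mulNr mulrBr; lra.
Qed.

(** A mean value inequality: [g] bounds the derivative of [f], and [G] grows at
    least as fast as [g] does to the right of each point. *)
Lemma delta_deriv_le (R : realType) (S : set R) (a b : R) (f d g G : R -> R)
    (s t : R) : compact_ts S a b -> S s -> S t -> s <= t ->
  (forall u, S u -> s < u <= t -> f x @[x --> within S (nbhs u)] --> f u) ->
  (forall u, S u -> s < u <= t -> G x @[x --> within S (nbhs u)] --> G u) ->
  (forall u, S u -> s <= u < t -> is_delta_deriv S f u (d u)) ->
  (forall u, S u -> s <= u < t -> d u <= g u) ->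
  (forall u x, S u -> S x -> s <= u < x -> g u * (x - u) <= G x - G u) ->
  f t - f s <= G t - G s.
Proof.
move=> tsS Ss St st fc Gc fd dg Gg; suff : G s - f s <= G t - f t by lra.
have cS : closed S by case: tsS.
apply: (@increments_ge0 _ S (fun x => G x - f x)) => //.
  by move=> u Su sut; apply: cvgB; [exact: Gc|exact: fc].
move=> u e Su /andP[su ut] e0; have sut : s <= u < t by rewrite su.
have ub : u < b by case: tsS => _ _ _ /(_ _ St)/andP[_]; exact: lt_le_trans.
have [u' [Su' uu' u'P]] := delta_deriv_right Su tsS ub (fd u Su sut) e0.
exists u'; split=> // x Sx uxu; have := u'P x Sx uxu; case/andP: uxu => ux _.
have := Gg u x Su Sx; rewrite su ux => /(_ isT); rewrite ler_norml => H /andP[_ H2].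
have : d u * (x - u) <= g u * (x - u) by rewrite ler_wpM2r ?subr_ge0 ?(ltW ux)// dg.
by rewrite mulNr; lra.
Qed.

Lemma delta_deriv_norm_le (R : realType) (S : set R) (a b : R)
    (f d g G : R -> R) (s t : R) : compact_ts S a b -> S s -> S t -> s <= t ->
  cont_on S f -> cont_on S G ->
  (forall u, S u -> s <= u < t -> is_delta_deriv S f u (d u)) ->
  (forall u, S u -> s <= u < t -> `|d u| <= g u) ->
  (forall u x, S u -> S x -> s <= u < x -> g u * (x - u) <= G x - G u) ->
  `|f t - f s| <= G t - G s.
Proof.
move=> tsS Ss St st fc Gc fd dg Gg; rewrite ler_norml; apply/andP; split; last first.
  apply: (delta_deriv_le tsS Ss St st _ _ fd _ Gg).
  - by move=> u Su _; exact: fc.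
  - by move=> u Su _; exact: Gc.
  - by move=> u Su su; exact: le_trans (ler_norm _) (dg u Su su).
rewrite lerNl opprB.
have := @delta_deriv_le _ S a b (fun x => -1 * f x) (fun x => -1 * d x) g G s t
  tsS Ss St st; rewrite !mulN1r opprK addrC; apply => //.
- move=> u Su _; apply: cvgM; [exact: cvg_cst|exact: fc].
- by move=> u Su _; exact: Gc.
- by move=> u Su sut; apply: delta_derivZ; exact: fd.
- move=> u Su sut; rewrite mulN1r; apply: le_trans (dg u Su sut).
  by rewrite -normrN ler_norm.
Qed.

Lemma delta_deriv_ge (R : realType) (S : set R) (a b : R) (f d : R -> R)
    (c s t : R) : compact_ts S a b -> S s -> S t -> s <= t ->
  cont_on S f -> (forall x, S x -> s <= x < t -> is_delta_deriv S f x (d x)) ->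
  (forall x, S x -> s <= x < t -> c <= d x) -> c * (t - s) <= f t - f s.
Proof.
move=> tsS Ss St st fc fd cd.
have := @delta_deriv_le _ S a b (fun x => -1 * f x) (fun x => -1 * d x) (fun=> - c)
  (fun x => - c * x) s t tsS Ss St st; move=> H.
suff : -1 * f t - -1 * f s <= - c * t - - c * s by lra.
apply: H.
- by move=> x Sx _; apply: cvgM; [exact: cvg_cst|exact: fc].
- by move=> x Sx _; apply: cvgM; [exact: cvg_cst|exact: cvg_within].
- by move=> x Sx xs; apply: delta_derivZ; exact: fd.
- by move=> x Sx xs; have := cd x Sx xs; lra.
- by move=> x y _ _ _; rewrite mulrBr.
Qed.

Lemma delta_deriv0_const (R : realType) (S : set R) (a b : R) (f : R -> R) :
  compact_ts S a b -> cont_on S f ->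
  (forall u, S u -> u < b -> is_delta_deriv S f u 0) ->
  forall t, S t -> f t = f a.
Proof.
move=> tsS fc fd t St; have [_ Sa _ Sab] := tsS; have /andP[at_ tb] := Sab _ St.
apply/eqP; rewrite -subr_eq0 -normr_le0.
have := @delta_deriv_norm_le _ S a b f (fun=> 0) (fun=> 0) (fun=> 0) a t tsS Sa St
  at_ fc; rewrite subrr; apply.
- by move=> u Su; exact: cvg_cst.
- by move=> u Su /andP[_ ut]; apply: fd => //; exact: lt_le_trans tb.
- by move=> u _ _; rewrite normr0.
- by move=> u x _ _ _; rewrite mul0r.
Qed.

(** * Antiderivatives *)

Definition super_increments (R : realType) (S : set R) (f G : R -> R) : Prop :=
  forall s t c, S s -> S t -> s <= t ->
    (forall u, S u -> s <= u < t -> c <= f u) -> c * (t - s) <= G t - G s.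

(** The upper Darboux integral, defined without partitions: it is the least
    function starting from [0] whose increments dominate every lower bound of the
    integrand. It makes sense for any bounded integrand, and minimality yields
    the upper bounds on its increments. *)
Definition upper_integral (R : realType) (S : set R) (a : R) (f : R -> R)
    (t : R) : R :=
  inf [set G t | G in [set G | super_increments S f G /\ G a = 0]].

Section upper_integral.
Variables (R : realType) (S : set R) (a b B : R) (f : R -> R).
Hypotheses (tsS : compact_ts S a b).
Hypothesis fB : forall u, S u -> u < b -> `|f u| <= B.
Let Sa : S a. Proof. by case: tsS. Qed.
Let Sle t : S t -> t <= b. Proof. by case: tsS => _ _ _ /[apply] /andP[]. Qed.
Let Sge t : S t -> a <= t. Proof. by case: tsS => _ _ _ /[apply] /andP[]. Qed.

Local Notation Gs := [set G | super_increments S f G /\ G a = 0].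

Let linGs : Gs (fun t => B * (t - a)).
Proof.
split; last by rewrite subrr mulr0.
move=> s t c Ss St; rewrite le_eqVlt => /predU1P[->|st] cf; first by rewrite !subrr mulr0.
have -> : B * (t - a) - B * (s - a) = B * (t - s) by ring.
rewrite ler_wpM2r ?subr_ge0 ?(ltW st)//.
apply: le_trans (cf s Ss _) _; first by rewrite lexx st.
by apply: le_trans (ler_norm _) (fB Ss _); exact: lt_le_trans (Sle St).
Qed.

Let Gs_lb t : S t -> has_inf [set G t | G in Gs].
Proof.
move=> St; split; first by exists (B * (t - a)); exists (fun t => B * (t - a)).
exists (- B * (t - a)) => _ [G [GI Ga] <-].
have := GI a t (- B) Sa St (Sge St); rewrite Ga subr0; apply=> u Su /andP[_ ut].
have := fB Su (lt_le_trans ut (Sle St)); by rewrite ler_norml => /andP[].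
Qed.

Lemma upper_integral0 : upper_integral S a f a = 0.
Proof.
apply/eqP; rewrite eq_le; apply/andP; split.
  apply: ge_inf; first by have [] := Gs_lb Sa.
  by exists (fun t => B * (t - a)); [exact: linGs|rewrite subrr mulr0].
by apply: lb_le_inf; [have [] := Gs_lb Sa|move=> _ [G [_ Ga] <-]; rewrite Ga].
Qed.

Lemma upper_integral_super : super_increments S f (upper_integral S a f).
Proof.
move=> s t c Ss St st cf; rewrite lerBrDr; apply: lb_le_inf.
  by have [] := Gs_lb St.
move=> _ [G [GI Ga] <-]; have := GI s t c Ss St st cf.
have : upper_integral S a f s <= G s.
  by apply: ge_inf; [have [] := Gs_lb Ss|exists G].
lra.
Qed.

(** Minimality: replacing the upper integral by a line of slope [c] on [s, t]
    gives another competitor. *)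
Lemma upper_integral_sub s t c : S s -> S t -> s <= t ->
  (forall u, S u -> s <= u < t -> f u <= c) ->
  upper_integral S a f t - upper_integral S a f s <= c * (t - s).
Proof.
move=> Ss St st fc; set F := upper_integral S a f.
pose G u := if u <= s then F u else if u <= t then F s + c * (u - s)
            else F s + c * (t - s) + F u - F t.
have Gs_ u : u <= s -> G u = F u by rewrite /G => ->.
have Gst u : s <= u -> u <= t -> G u = F s + c * (u - s).
  rewrite /G => su ut; rewrite ut; have [us|//] := leP u s.
  have -> : u = s by apply/eqP; rewrite eq_le us.
  by rewrite subrr mulr0 addr0.
have Gt u : t <= u -> G u = F s + c * (t - s) + F u - F t.
  move=> tu; have := tu; rewrite le_eqVlt => /predU1P[<-|tu'].
    by rewrite Gst//; ring.
  rewrite /G leNgt (le_lt_trans st tu') /= leNgt tu' //.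
have Fsup := upper_integral_super.
(* Domination of increments is additive, so it is enough to check it on
   intervals that do not cross [s] or [t]. *)
have Gsup1 x y e : S x -> S y -> x <= y -> y <= s \/ (s <= x /\ y <= t) \/ t <= x ->
    (forall u, S u -> x <= u < y -> e <= f u) -> e * (y - x) <= G y - G x.
  move=> Sx Sy xy [ys|[[sx yt]|tx]] ef.
  - by rewrite !Gs_//; [exact: Fsup|exact: (le_trans xy ys)].
  - have sy := le_trans sx xy; have xt := le_trans xy yt; rewrite !Gst//.
    have -> : F s + c * (y - s) - (F s + c * (x - s)) = c * (y - x) by ring.
    move: xy; rewrite le_eqVlt => /predU1P[->|xy]; first by rewrite subrr !mulr0.
    rewrite ler_wpM2r ?subr_ge0 ?(ltW xy)//; apply: le_trans (ef x Sx _) (fc x Sx _).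
      by rewrite lexx.
    by rewrite sx (lt_le_trans xy yt).
  - rewrite !Gt//; last exact: (le_trans tx xy).
    have := Fsup x y e Sx Sy xy ef; rewrite -/F; lra.
have Gsup2 x y e : S x -> S y -> x <= y -> y <= s \/ s <= x ->
    (forall u, S u -> x <= u < y -> e <= f u) -> e * (y - x) <= G y - G x.
  move=> Sx Sy xy [ys|sx] ef; first by apply: Gsup1 => //; left.
  have [yt|ty] := leP y t; first by apply: Gsup1 => //; right; left.
  have [tx|xt] := leP t x; first by apply: Gsup1 => //; right; right.
  have := @Gsup1 x t e Sx St (ltW xt); have := @Gsup1 t y e St Sy (ltW ty).
  move=> /(_ (or_intror (or_intror (lexx t)))) H1.
  move=> /(_ (or_intror (or_introl (conj sx (lexx t))))) H2.
  have {}H1 : e * (y - t) <= G y - G t.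
    by apply: H1 => u Su /andP[tu uy]; apply: ef => //; rewrite uy (le_trans (ltW xt) tu).
  have {}H2 : e * (t - x) <= G t - G x.
    by apply: H2 => u Su /andP[xu ut]; apply: ef => //; rewrite xu (lt_trans ut ty).
  lra.
have Gsup : super_increments S f G.
  move=> x y e Sx Sy xy ef; have [ys|sy] := leP y s; first by apply: Gsup2 => //; left.
  have [sx|xs] := leP s x; first by apply: Gsup2 => //; right.
  have H2 : e * (s - x) <= G s - G x.
    apply: Gsup2 => //; [exact: ltW|by left|].
    by move=> u Su /andP[xu us]; apply: ef => //; rewrite xu (lt_trans us sy).
  have H1 : e * (y - s) <= G y - G s.
    apply: Gsup2 => //; [exact: ltW|by right|].
    by move=> u Su /andP[su uy]; apply: ef => //; rewrite uy (le_trans (ltW xs) su).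
  lra.
have : F t <= G t.
  apply: ge_inf; first by have [] := Gs_lb St.
  by exists G => //; split=> //; rewrite Gs_ ?Sge//; exact: upper_integral0.
by rewrite Gst//; lra.
Qed.

(** At a right-scattered point the increment over the gap is exact and
    boundedness controls the rest; at a right-dense point continuity of [f]
    pinches both bounds. *)
Lemma upper_integral_deriv t : S t -> t < b \/ sigma S t = t ->
  (sigma S t = t -> forall e, 0 < e -> exists2 r, 0 < r &
     forall s, S s -> s < b \/ s = t -> `|s - t| < r -> `|f s - f t| <= e) ->
  is_delta_deriv S (upper_integral S a f) t (f t).
Proof.
move=> St tb ft e e0; set F := upper_integral S a f.
have [tst|tst] := eqVneq (sigma S t) t.
  rewrite tst; have [r r0 rP] := ft tst e e0; exists r => // s Ss.
  rewrite -ltr_distl => st; have [ts|] := leP t s.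
    have fe u : S u -> t <= u < s -> f t - e <= f u <= f t + e.
      move=> Su /andP[tu us]; have : `|f u - f t| <= e.
        apply: rP => //; first by left; exact: lt_le_trans (Sle Ss).
        by move: st; rewrite !ger0_norm ?subr_ge0//; lra.
      by rewrite ler_norml => ?; apply/andP; split; lra.
    have := upper_integral_super St Ss ts (fun u Su tu => proj1 (andP (fe u Su tu))).
    have := upper_integral_sub St Ss ts (fun u Su tu => proj2 (andP (fe u Su tu))).
    rewrite -/F (ler0_norm (_ : t - s <= 0)) ?subr_le0// ler_norml => ? ?.
    by apply/andP; split; lra.
  move=> st'; have ts := ltW st'.
  have fe u : S u -> s <= u < t -> f t - e <= f u <= f t + e.
    move=> Su /andP[su ut]; have : `|f u - f t| <= e.
      apply: rP => //; first by left; exact: lt_le_trans (Sle St).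
      by move: st; rewrite !ltr0_norm ?subr_lt0//; lra.
    by rewrite ler_norml => ?; apply/andP; split; lra.
  have := upper_integral_super Ss St ts (fun u Su tu => proj1 (andP (fe u Su tu))).
  have := upper_integral_sub Ss St ts (fun u Su tu => proj2 (andP (fe u Su tu))).
  rewrite -/F (ger0_norm (_ : 0 <= t - s)) ?subr_ge0// ler_norml => ? ?.
  by apply/andP; split; lra.
have {}tb : t < b by case: tb tst => // ->; rewrite eqxx.
have tst' : t < sigma S t by rewrite lt_neqAle eq_sym tst (sigma_ge tsS (ltW tb)).
have Ss := sigma_in tsS (ltW tb).
have only u : S u -> t <= u < sigma S t -> u = t.
  move=> Su /andP[]; rewrite le_eqVlt => /predU1P[->//|tu].
  by rewrite ltNge (sigma_le tsS Su tu).
have Fst : F (sigma S t) - F t = f t * (sigma S t - t).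
  apply/eqP; rewrite eq_le; apply/andP; split.
    by apply: upper_integral_sub => // [|u Su /(only _ Su) ->//]; exact: ltW.
  by apply: upper_integral_super => // [|u Su /(only _ Su) ->//]; exact: ltW.
have B0 : 0 <= B by apply: le_trans (fB St tb).
have mu0 : 0 < sigma S t - t by rewrite subr_gt0.
(* The first bound keeps [s] on the left of the gap; under the second one the
   increment over [s, t], at most [(2 * B + 1) * (t - s)] away from its target, is
   negligible against the length of the gap. *)
exists (Num.min (sigma S t - t) (e * (sigma S t - t) / (2 * B + 1))).
  by rewrite lt_min mu0 divr_gt0// ?mulr_gt0//; lra.
move=> s Ss'; rewrite -ltr_distl lt_min => /andP[st1 st2].
have st : s <= t.
  rewrite leNgt; apply/negP => ts; have := sigma_le tsS Ss' ts.
  by move: st1; rewrite gtr0_norm ?subr_gt0//; lra.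
have H u : S u -> s <= u < t -> - B <= f u <= B.
  by move=> Su /andP[_ ut]; rewrite -ler_norml; apply: fB => //; exact: lt_trans tb.
have F1 := upper_integral_super Ss' St st (fun u Su tu => proj1 (andP (H u Su tu))).
have F2 := upper_integral_sub Ss' St st (fun u Su tu => proj2 (andP (H u Su tu))).
have -> : F (sigma S t) - F s - f t * (sigma S t - s)
   = F t - F s - f t * (t - s) by rewrite -[F (sigma S t)](subrK (F t)) Fst; ring.
have ftB : - B <= f t <= B by rewrite -ler_norml fB.
have : `|F t - F s - f t * (t - s)| <= (2 * B + 1) * (t - s).
  have ts0 : 0 <= t - s by rewrite subr_ge0.
  rewrite ler_norml; move: F1 F2 ftB; rewrite -/F => F1 F2 /andP[f1 f2].
  have := ler_wpM2r ts0 f1; have := ler_wpM2r ts0 f2; rewrite !mulrDl mul1r => ? ?.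
  by apply/andP; split; lra.
move/le_trans; apply; rewrite gtr0_norm ?subr_gt0 ?(le_lt_trans st)//.
apply: le_trans (_ : e * (sigma S t - t) <= _); last by rewrite ler_wpM2l ?(ltW e0)//; lra.
move: st2; rewrite ler0_norm ?subr_le0// opprB ltr_pdivlMr; last lra.
by rewrite mulrC => /ltW.
Qed.

End upper_integral.

Lemma antiderivative_upper_integral (R : realType) (S : set R) (a b m B : R)
    (f : R -> R) : kappa_ts S a b m ->
  (forall t, kappa S t -> `|f t| <= B) ->
  (forall t, kappa S t -> sigma S t = t ->
     f s @[s --> within (kappa S) (nbhs t)] --> f t) ->
  antiderivative S f (upper_integral S a f).
Proof.
move=> kS fB fc t Kt; have St := kappa_sub Kt; have tsS := kappa_ts_base kS.
have /andP[_ tb] := kappa_ts_le kS St.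
apply: (upper_integral_deriv tsS (B := B)) => //.
- by move=> u Su ub; apply: fB; exact: (kappa_lt kS).
- move: tb; rewrite [_ <= b]le_eqVlt => /predU1P[->|]; last by left.
  by right; exact: (sigma_max tsS).
- move=> tst e e0; have /cvg_withinP/(_ e e0)[r r0 rP] := fc t Kt tst.
  exists r => // s Ss sbt; apply: rP.
  by case: sbt => [sb|->//]; exact: (kappa_lt kS).
Qed.

Lemma delta_integralE (R : realType) (S : set R) (a b m : R) (f F : R -> R) :
  kappa_ts S a b m -> antiderivative S f F -> delta_integral S a b f = F b - F a.
Proof.
move=> kS fF; rewrite /delta_integral.
have /(xgetPex 0)[G fG ->] : exists v, [set v | exists2 F, antiderivative S f F &
    v = F b - F a] v by exists (F b - F a); exists F.
have tsS := kappa_ts_base kS; have [_ Sa Sb _] := tsS.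
have FGc : cont_on S (fun t => G t - F t).
  apply: (delta_deriv_cont_on (d := fun t => f t - f t) kS) => t Kt.
  by apply: delta_derivB; [exact: fG|exact: fF].

have : G b - F b = G a - F a.
  apply: (delta_deriv0_const tsS FGc _ Sb) => u Su ub; rewrite -(subrr (f u)); have Ku := kappa_lt kS Su ub.
  by apply: delta_derivB; [exact: fG|exact: fF].
lra.
Qed.

(** * Existence for initial value problems *)

Lemma half_pow_small (R : realType) (c e : R) : 0 < e ->
  exists n, c / 2 ^+ n <= e.
Proof.
move=> e0; exists (Num.bound (`|c| / e)); rewrite ler_pdivrMr ?exprn_gt0//.
apply: le_trans (ler_norm c) _; rewrite mulrC -ler_pdivrMr//.
apply/ltW; apply: lt_le_trans (archi_boundP _) _; first by rewrite divr_ge0// ltW.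
by rewrite -natrX ler_nat ltnW// ltn_expl.
Qed.

Lemma cont_on_uniform_limit (R : realType) (K : set R) (v : R -> R) :
  (forall e, 0 < e -> exists2 w, cont_on K w & forall t, K t -> `|v t - w t| <= e) ->
  cont_on K v.
Proof.
move=> vlim t Kt; apply/cvg_withinP => e e0; have e3 : 0 < e / 3 by lra.
have [w wc vw] := vlim _ e3; have /cvg_withinP/(_ _ e3)[r r0 rP] := wc t Kt.
exists r => // s Ks st; have := rP s Ks st; have := vw s Ks; have := vw t Kt.
rewrite !ler_norml => /andP[? ?] /andP[? ?] /andP[? ?]; apply/andP; split; lra.
Qed.

(** Fixed point iteration for a map that halves distances in a norm weighted by
    [E], on a class [C] of functions. *)
Section picard.
Variables (R : realType) (K : set R) (E : R -> R) (C : (R -> R) -> Prop).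
Variables (Phi : (R -> R) -> R -> R) (v0 : R -> R) (A0 : R).
Hypotheses (C0 : C v0) (CPhi : forall v, C v -> C (Phi v)).
Hypothesis PhiE : forall v w A, C v -> C w ->
  (forall t, K t -> `|v t - w t| <= A * E t) ->
  forall t, K t -> `|Phi v t - Phi w t| <= A / 2 * E t.
Hypothesis A0P : forall t, K t -> `|Phi v0 t - v0 t| <= A0 * E t.

Lemma picard_iter_closed n : C (iter n Phi v0).
Proof. by elim: n => // n; exact: CPhi. Qed.

(** The iterates, widened by the error that remains, form nested intervals. *)
Lemma picard_limit : exists v, forall n t, K t ->
  `|v t - iter n Phi v0 t| <= 2 * A0 / 2 ^+ n * E t.
Proof.
have step n t : K t -> `|iter n.+1 Phi v0 t - iter n Phi v0 t| <= A0 / 2 ^+ n * E t.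
  elim: n t => [|n IHn] t Kt; first by rewrite expr0 divr1; exact: A0P.
  rewrite exprSr invfM mulrA; 
  apply: PhiE => //; [exact: (picard_iter_closed n.+1)|exact: picard_iter_closed].
pose r n t := 2 * A0 / 2 ^+ n * E t.
have rS n t : r n t - r n.+1 t = A0 / 2 ^+ n * E t.
  by rewrite /r exprS; field; rewrite expf_neq0// pnatr_eq0.
pose l n t := iter n Phi v0 t - r n t; pose h n t := iter n Phi v0 t + r n t.
have r0 n t : K t -> 0 <= r n t.
  move=> Kt; have -> : r n t = 2 * (A0 / 2 ^+ n * E t) by rewrite /r; ring.
  by rewrite mulr_ge0// (le_trans (normr_ge0 _) (step n t Kt)).
have lS n t : K t -> l n t <= l n.+1 t.
  by move=> Kt; have := step n t Kt; rewrite -rS /l ler_norml /= => /andP[? _]; lra.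
have hS n t : K t -> h n.+1 t <= h n t.
  by move=> Kt; have := step n t Kt; rewrite -rS /h ler_norml /= => /andP[_ ?]; lra.
have lm t : K t -> {homo l^~ t : i j / (i <= j)%N >-> i <= j}.
  by move=> Kt; apply: homo_leq => [|y x z xy yz|i]; [exact: lexx|exact: (le_trans xy yz)|exact: lS].
have hm t : K t -> {homo h^~ t : i j / (i <= j)%N >-> j <= i}.
  move=> Kt; apply: (homo_leq (r := fun x y : R => y <= x)) => [x|y x z xy yz|i].
  - exact: lexx.
  - exact: (le_trans yz xy).
  - exact: hS.
have lh i j t : K t -> l i t <= h j t.
  move=> Kt; apply: le_trans (lm t Kt _ _ (leq_maxl i j)) _.
  apply: le_trans (hm t Kt _ _ (leq_maxr i j)).
  by have := r0 (maxn i j) t Kt; rewrite /l /h; lra.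
exists (fun t => sup [set l n t | n in setT]) => n t Kt.
have lsup : l n t <= sup [set l n t | n in setT].
  by apply: ub_le_sup; [exists (h 0%N t) => _ [i _ <-]; exact: lh|exists n].
have suph : sup [set l n t | n in setT] <= h n t.
  by apply: ge_sup; [exists (l 0%N t); exists 0%N|move=> _ [i _ <-]; exact: lh].
by rewrite ler_norml -/(r n t); move: lsup suph; rewrite /l /h => ? ?; apply/andP; split; lra.
Qed.

End picard.

(** A solution with its derivative [v] carried along as a function, so that
    nothing has to be said about the derivative chosen by [delta_deriv]. *)
Definition sl_pair (R : realType) (S : set R) (q : R -> R) (lambda : R)
    (u v : R -> R) : Prop :=
  (forall t, kappa S t -> is_delta_deriv S u t (v t)) /\
  (forall t, kappa (kappa S) t -> is_delta_deriv (kappa S) v t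
     (- (q t + lambda) * u (sigma (kappa S) t))).

Section sturm_liouville.
Variables (R : realType) (S : set R) (a b m m' : R) (q : R -> R).
Hypotheses (kS : kappa_ts S a b m) (kK : kappa_ts (kappa S) a m m').
Hypotheses (am : a < m) (qc : cont_on S q).
Local Notation K := (kappa S).
Let tsS := kappa_ts_base kS.
Let tsK := kappa_ts_kappa kS.
Let Sa : S a. Proof. by case: tsS. Qed.
Let Ka : K a. Proof. by case: tsK. Qed.
Let Sb : S b. Proof. by case: tsS. Qed.
Let Km : K m. Proof. by case: tsK. Qed.
Let KS t : K t -> S t. Proof. exact: kappa_sub. Qed.
Let mb : m <= b. Proof. exact: (kappa_ts_max_le kS). Qed.
Let ab : a < b. Proof. exact: (lt_le_trans am mb). Qed.
Let Kam t : K t -> a <= t <= m. Proof. exact: (kappa_ts_le kK). Qed.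
Let Sab t : S t -> a <= t <= b. Proof. exact: (kappa_ts_le kS). Qed.

Definition weight (L t : R) : R := expR (L * (t - a)).

Lemma weight_increment (L s t : R) :
  L * weight L s * (t - s) <= weight L t - weight L s.
Proof.
have -> : weight L t = weight L s * expR (L * (t - s)).
  by rewrite /weight -expRD; congr expR; ring.
have := expR_ge1Dx (L * (t - s)); have := expR_gt0 (L * (s - a)).
rewrite -/(weight L s) => w0 /(ler_wpM2l (ltW w0)); lra.
Qed.

Lemma weight_gt0 L t : 0 < weight L t. Proof. exact: expR_gt0. Qed.

Lemma weight_le L s t : 0 <= L -> s <= t -> weight L s <= weight L t.
Proof.
by move=> L0 st; rewrite /weight ler_expR ler_wpM2l// lerD2r.
Qed.

Lemma weight_ge1 L t : 0 <= L -> a <= t -> 1 <= weight L t.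
Proof.
by move=> L0 at_; rewrite -expR0 /weight ler_expR mulr_ge0// subr_ge0.
Qed.

Lemma weight_cont (D : set R) L : cont_on D (weight L).
Proof.
apply/subspace_continuousP; apply: continuous_subspaceT => t.
apply: continuous_comp; last exact: continuous_expR.
apply: cvgM; first exact: cvg_cst.
by apply: cvgB; [exact: cvg_id|exact: cvg_cst].
Qed.

(** The estimate behind existence, uniqueness and dependence on parameters.
    With [u] an antiderivative of [w] and [x] one of a quantity controlled by
    [u], two integrations against an exponential of rate [L] halve the weighted
    bound of [w]. *)
Lemma weighted_contraction (u w x f : R -> R) (A M beta L : R) :
  (forall t, K t -> is_delta_deriv S u t (w t)) ->
  (forall t, K t -> t < m -> is_delta_deriv K x t (f t)) -> cont_on K x ->
  (forall t, K t -> `|w t| <= A * weight L t) ->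
  (forall t, K t -> t < m -> `|f t| <= M * `|u (sigma K t)| + beta) ->
  0 < L -> 2 * M * (b - a) <= L -> 0 <= M -> 0 <= beta ->
  forall t, K t ->
    `|x t - x a| <= (A / 2 + (M * `|u a| + beta) / L) * weight L t.
Proof.
move=> uw xf xc wA fM L0 ML M0 beta0 t Kt.
have uc : cont_on S u := delta_deriv_cont_on kS uw.
have A0 : 0 <= A.
  have := wA a Ka; rewrite {1}/weight subrr mulr0 expR0 mulr1.
  exact: le_trans.
have uS s : K s -> s < m -> `|u (sigma K s)| <= `|u a| + A * weight L s * (b - a).
  move=> Ks sm; have Ss := KS Ks; have sb := lt_le_trans sm mb.
  rewrite (sigma_kappa kS sm); have Ssig := sigma_in tsS (ltW sb).
  have /andP[asig sigb] := Sab Ssig.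
  have : `|u (sigma S s) - u a| <= A * weight L s * sigma S s - A * weight L s * a.
    apply: (@delta_deriv_norm_le _ S a b u w (fun=> A * weight L s)
      (fun x => A * weight L s * x) _ _ tsS) => //.
    - by move=> y Sy; apply: cvgM; [exact: cvg_cst|exact: cvg_within].
    - by move=> y Sy /andP[ay ys]; apply: uw; exact: (kappa_lt_trans kS Sy Ssig).
    - move=> y Sy /andP[ay ys]; apply: le_trans (wA y _) _.
        exact: (kappa_lt_trans kS Sy Ssig).
      rewrite ler_wpM2l//; apply: weight_le; first exact: ltW.
      by rewrite leNgt; apply/negP => sy; move: ys; rewrite ltNge (sigma_le tsS Sy sy).
    - by move=> y z _ _ _; rewrite mulrBr.
  have := ler_normD (u (sigma S s) - u a) (u a); rewrite subrK => H1 H2.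
  have : A * weight L s * (sigma S s - a) <= A * weight L s * (b - a).
    by rewrite ler_wpM2l ?mulr_ge0 ?(ltW (weight_gt0 _ _))// lerD2r.
  lra.
pose c := A / 2 + (M * `|u a| + beta) / L.
have cL : c * L = A / 2 * L + (M * `|u a| + beta).
  by rewrite /c mulrDl divfK// gt_eqF.
have B0 : 0 <= M * `|u a| + beta by rewrite addr_ge0 ?mulr_ge0.
have c0 : 0 <= c by rewrite /c addr_ge0 ?divr_ge0// ltW.
have := @delta_deriv_norm_le _ K a m x f (fun s => c * L * weight L s)
  (fun s => c * weight L s) a t tsK Ka Kt.
have /andP[at_ tm] := Kam Kt; move=> /(_ at_ xc) H.
have {}H : `|x t - x a| <= c * weight L t - c * weight L a.
  apply: H.
  - by move=> s Ks; apply: cvgM; [exact: cvg_cst|exact: weight_cont].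
  - by move=> s Ks /andP[_ st]; apply: xf => //; exact: (lt_le_trans st tm).
  - move=> s Ks /andP[as_ st]; have sm := lt_le_trans st tm.
    apply: le_trans (fM s Ks sm) _; rewrite cL mulrDl.
    have w1 := weight_ge1 (ltW L0) as_.
    have H1 := ler_wpM2l M0 (uS s Ks sm).
    have H2 : 0 <= A * weight L s by rewrite mulr_ge0// ltW// weight_gt0.
    have H3 := ler_wpM2l H2 ML.
    have H4 := ler_wpM2l B0 w1.
    move: H1 H3 H4; set d := b - a; set W := weight L s; set U := `|u a|; set V := `|u _|.
    by move=> H1 H3 H4; lra.
  - move=> s y _ _ _; have := ler_wpM2l c0 (weight_increment L s y).
    lra.
by apply: le_trans H _; rewrite lerBlDr lerDl mulr_ge0// ltW// weight_gt0.
Qed.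

Lemma potential_bound (lambda : R) :
  exists2 M, 0 < M & forall t, S t -> `|q t + lambda| <= M.
Proof.
have [Q Q0 qQ] := cont_on_bounded tsS qc.
exists (Q + `|lambda|); first by rewrite ltr_wpDr.
by move=> t /qQ qt; apply: le_trans (ler_normD _ _) _; rewrite lerD2r.
Qed.

(** The solution of the initial value problem [u a = e], [v a = h] is found as a
    fixed point of [ivp_step] in the slope [v] alone. The value of [u] at
    [sigma K t] then involves only slopes at points up to [t], even across a gap,
    which is what keeps the iteration explicit. *)
Definition ivp_value (e : R) (v : R -> R) (t : R) : R :=
  e + upper_integral S a v t.

Definition ivp_slope (lambda e : R) (v : R -> R) (t : R) : R :=
  - (q t + lambda) * ivp_value e v (sigma K t).

Definition ivp_step (lambda e h : R) (v : R -> R) (t : R) : R :=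
  h + upper_integral K a (ivp_slope lambda e v) t.

Lemma ivp_value_deriv e v : cont_on K v ->
  forall t, K t -> is_delta_deriv S (ivp_value e v) t (v t).
Proof.
move=> vc t Kt; have [B _ vB] := cont_on_bounded tsK vc.
apply: delta_derivDcst; apply: (antiderivative_upper_integral kS vB) => //.
by move=> s Ks _; exact: vc.
Qed.

Lemma ivp_value_cont e v : cont_on K v -> cont_on S (ivp_value e v).
Proof. by move=> vc; apply: (delta_deriv_cont_on kS (d := v)); exact: ivp_value_deriv. Qed.

Lemma ivp_value_init e v : cont_on K v -> ivp_value e v a = e.
Proof.
move=> vc; have [B _ vB] := cont_on_bounded tsK vc.
rewrite /ivp_value (upper_integral0 (B := B) tsS) ?addr0// => u Su ub.
by apply: vB; exact: (kappa_lt kS).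
Qed.

Lemma shift_bounded (lambda : R) (u : R -> R) : cont_on S u ->
  exists2 B, 0 < B & forall t, K t -> `|- (q t + lambda) * u (sigma K t)| <= B.
Proof.
move=> uc; have [B B0 uB] := cont_on_bounded tsS uc.
have [M M0 qM] := potential_bound lambda.
exists (M * B); first exact: mulr_gt0.
move=> t Kt; rewrite normrM normrN; apply: ler_pM => //; first exact: qM (KS Kt).
by apply: uB; apply: KS; exact: (sigma_kappa_in kS).
Qed.

(** The set [A] allows for two-sided limits at right-dense points and for
    left-sided ones elsewhere. *)
Lemma shift_cvg (A : set R) (lambda : R) (u : R -> R) (t : R) :
  cont_on S u -> K t -> A `<=` K ->
  sigma K s @[s --> within A (nbhs t)] --> t ->
  - (q s + lambda) * u (sigma K s) @[s --> within A (nbhs t)]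
    --> - (q t + lambda) * u t.
Proof.
move=> uc Kt AK st; have St := KS Kt; apply: cvgM.
  apply: cvgN; apply: cvgD; last exact: cvg_cst.
  by apply: cvg_withinS (qc St) => s /AK; exact: KS.
apply/cvg_withinP => e e0; have /cvg_withinP/(_ e e0)[r r0 rP] := uc t St.
have r20 : 0 < r / 2 by lra.
move/cvg_withinP/(_ _ r20): st => [d d0 dP]; exists d => // s As sd.
apply: rP; first by apply: KS; apply: (sigma_kappa_in kS); exact: AK.
by apply: le_lt_trans (dP s As sd) _; lra.
Qed.

Lemma ivp_step_deriv lambda e h v : cont_on K v ->
  forall t, kappa K t ->
    is_delta_deriv K (ivp_step lambda e h v) t (ivp_slope lambda e v t).
Proof.
move=> vc t Kt; have uc : cont_on S (ivp_value e v) := ivp_value_cont vc.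
have [B _ uB] := shift_bounded lambda uc.
apply: delta_derivDcst; apply: (antiderivative_upper_integral kK (B := B)) => //.
  by move=> s /kappa_sub; exact: uB.
move=> s Ks ss; rewrite /ivp_slope ss; apply: shift_cvg => //.
- exact: kappa_sub.
- exact: kappa_sub.
- apply: cvg_withinS (sigma_cvg tsK (kappa_sub Ks) ss); exact: kappa_sub.
Qed.

Lemma ivp_step_cont lambda e h v : cont_on K v -> cont_on K (ivp_step lambda e h v).
Proof.
move=> vc; apply: (delta_deriv_cont_on kK (d := ivp_slope lambda e v)).
exact: ivp_step_deriv.
Qed.

Lemma ivp_step_init lambda e h v : cont_on K v -> ivp_step lambda e h v a = h.
Proof.
move=> vc; have [B _ uB] := shift_bounded lambda (ivp_value_cont (e := e) vc).
rewrite /ivp_step (upper_integral0 (B := B) tsK) ?addr0// => u Ku um.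
exact: uB.
Qed.

Lemma ivp_step_contraction lambda e h :
  exists2 L, 0 <= L & forall v w A, cont_on K v -> cont_on K w ->
    (forall t, K t -> `|v t - w t| <= A * weight L t) ->
    forall t, K t ->
      `|ivp_step lambda e h v t - ivp_step lambda e h w t| <= A / 2 * weight L t.
Proof.
have [M M0 qM] := potential_bound lambda.
have L0 : 0 < 2 * M * (b - a) by rewrite !mulr_gt0// subr_gt0.
exists (2 * M * (b - a)); first exact: ltW.
move=> v w A vc wc vwA t Kt.
have := @weighted_contraction (fun s => ivp_value e v s - ivp_value e w s)
  (fun s => v s - w s)
  (fun s => ivp_step lambda e h v s - ivp_step lambda e h w s)
  (fun s => ivp_slope lambda e v s - ivp_slope lambda e w s) A M 0
  (2 * M * (b - a)).
rewrite !ivp_value_init// !ivp_step_init// !subrr normr0 mulr0 addr0 mul0r addr0.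
move=> H; have {}H := H _ _ _ vwA _ L0 (lexx _) (ltW M0) (lexx _) t Kt.
rewrite subr0 in H; apply: H.
- by move=> s Ks; apply: delta_derivB; exact: ivp_value_deriv.
- move=> s Ks sm; apply: delta_derivB; apply: ivp_step_deriv => //; exact: (kappa_lt kK).
- by move=> s Ks; apply: cvgB; exact: ivp_step_cont.
- move=> s Ks _; rewrite /ivp_slope -mulrBr normrM normrN addr0 ler_wpM2r//.
  exact: qM (KS Ks).
Qed.

Lemma upper_integral_ge0 (v : R -> R) : cont_on K v -> (forall t, K t -> 0 <= v t) ->
  forall t, S t -> 0 <= upper_integral S a v t.
Proof.
move=> vc v0 t St; have [B _ vB] := cont_on_bounded tsK vc.
have /andP[at_ _] := Sab St.
have vB' u : S u -> u < b -> `|v u| <= B.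
  by move=> Su ub; apply: vB; exact: (kappa_lt kS).
have := upper_integral_super tsS vB' (c := 0) Sa St at_.
rewrite (upper_integral0 tsS vB') mul0r subr0; apply.
by move=> u Su /andP[_ ut]; apply: v0; exact: (kappa_lt_trans kS Su St).
Qed.

(** When [q + lambda] is nonpositive, nonnegative slopes give nonnegative values,
    so that the second derivative is nonnegative. *)
Lemma ivp_step_ge lambda e h v : cont_on K v -> 0 <= e ->
  (forall t, S t -> q t + lambda <= 0) -> (forall t, K t -> 0 <= v t) ->
  forall t, K t -> h <= ivp_step lambda e h v t.
Proof.
move=> vc e0 q0 v0 t Kt; rewrite /ivp_step lerDl.
have uc : cont_on S (ivp_value e v) := ivp_value_cont vc.
have [B _ uB] := shift_bounded lambda uc.
have /andP[at_ tm] := Kam Kt.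
have uB' u : K u -> u < m -> `|ivp_slope lambda e v u| <= B by move=> Ku _; exact: uB.
have := upper_integral_super tsK uB' (c := 0) Ka Kt at_.
rewrite (upper_integral0 tsK uB') mul0r subr0; apply.
move=> u Ku _; rewrite /ivp_slope mulr_ge0//.
  by rewrite oppr_ge0; apply: q0; exact: KS.
rewrite /ivp_value addr_ge0//; apply: upper_integral_ge0 => //.
by apply: KS; exact: (sigma_kappa_in kS).
Qed.

Lemma ivp_exists (lambda e h : R) : exists u v,
  [/\ sl_pair S q lambda u v, u a = e, v a = h &
      0 <= e -> 0 <= h -> (forall t, S t -> q t + lambda <= 0) ->
      forall t, K t -> h <= v t].
Proof.
have [L L0 contr] := ivp_step_contraction lambda e h.
set Phi := ivp_step lambda e h in contr *.
have C0 : cont_on K (fun=> h : R) by move=> t Kt; exact: cvg_cst.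
have CPhi w : cont_on K w -> cont_on K (Phi w) by exact: ivp_step_cont.
have [A0 A00 A0P] := cont_on_bounded tsK (f := fun t => Phi (fun=> h) t - h)
  (fun t Kt => cvgB (CPhi _ C0 t Kt) (C0 t Kt)).
have A0W t : K t -> `|Phi (fun=> h) t - h| <= A0 * weight L t.
  move=> Kt; apply: le_trans (A0P t Kt) _; rewrite ler_peMr ?(ltW A00)//.
  by apply: weight_ge1 => //; have /andP[] := Kam Kt.
have [v vP] := picard_limit C0 CPhi contr A0W.
have iterc n : cont_on K (iter n Phi (fun=> h)) by exact: picard_iter_closed C0 CPhi n.
have vlim d : 0 < d -> exists n, forall t, K t ->
    2 * A0 / 2 ^+ n * weight L t <= d.
  move=> d0; have [n nP] := half_pow_small (2 * A0 * weight L m) d0.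
  exists n => t Kt; apply: le_trans nP; rewrite mulrAC ler_wpM2r ?invr_ge0 ?exprn_ge0//.
  rewrite ler_wpM2l ?mulr_ge0 ?(ltW A00)//; apply: weight_le => //.
  by have /andP[] := Kam Kt.
have vc : cont_on K v.
  apply: cont_on_uniform_limit => d d0; have [n nP] := vlim d d0.
  exists (iter n Phi (fun=> h)) => // t Kt; exact: le_trans (vP n t Kt) (nP t Kt).
have vfix t : K t -> Phi v t = v t.
  move=> Kt; apply/eqP; rewrite -subr_eq0 -normr_le0; apply/ler_addgt0Pl => d d0.
  have d20 : 0 < d / 2 by lra.
  have [n nP] := vlim _ d20; rewrite addr0.
  have H1 := contr _ _ _ vc (iterc n) (vP n) t Kt.
  have H2 := vP n.+1 t Kt; have H3 := nP t Kt.
  have := ler_normB (Phi v t - Phi (iter n Phi (fun=> h)) t)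
                   (v t - iter n.+1 Phi (fun=> h) t).
  have -> : Phi v t - Phi (iter n Phi (fun=> h)) t -
     (v t - iter n.+1 Phi (fun=> h) t) = Phi v t - v t by rewrite /=; ring.
  have E1 : 2 * A0 / 2 ^+ n / 2 * weight L t = 2 * A0 / 2 ^+ n * weight L t / 2 by ring.
  have E2 : 2 * A0 / 2 ^+ n.+1 * weight L t = 2 * A0 / 2 ^+ n * weight L t / 2.
    by rewrite exprSr; field; rewrite expf_neq0// pnatr_eq0.
  by rewrite E1 in H1; rewrite E2 in H2; lra.
exists (ivp_value e v), v; split.
- split=> t Kt; first exact: ivp_value_deriv.
  apply: (delta_deriv_ext (f := Phi v)) => //.
    by apply: (sigma_kappa_in kS); exact: kappa_sub.
  exact: ivp_step_deriv.
- exact: ivp_value_init.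
- by rewrite -vfix// /Phi ivp_step_init.
- move=> e0 h0 q0 t Kt.
  have iterh n s : K s -> h <= iter n Phi (fun=> h) s.
    elim: n s => [|n IHn] s Ks //=; apply: ivp_step_ge => //.
    by move=> x /IHn; apply: le_trans.
  apply/ler_addgt0Pr => d d0; have [n nP] := vlim d d0.
  have := vP n t Kt; have := nP t Kt; have := iterh n t Kt.
  by rewrite ler_norml => ? ? /andP[? _]; lra.
Qed.

(** * Dependence on the parameters *)

Lemma sl_pair_value_cont lambda u v : sl_pair S q lambda u v -> cont_on S u.
Proof. by case=> uv _; exact: (delta_deriv_cont_on kS uv). Qed.

Lemma sl_pair_slope_cont lambda u v : sl_pair S q lambda u v -> cont_on K v.
Proof.
case=> _ vf; apply: (delta_deriv_cont_on kK
  (d := fun t => - (q t + lambda) * u (sigma K t))); exact: vf.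
Qed.

(** Two solutions with the same initial slope: the contraction estimate, applied
    again and again to their difference, leaves only the source term. *)
Lemma sl_pair_dependence lambda0 u0 v0 : sl_pair S q lambda0 u0 v0 ->
  exists2 C, 0 < C & forall lambda u v, `|lambda - lambda0| <= 1 ->
    sl_pair S q lambda u v -> v a = v0 a ->
    forall t, K t ->
      `|v t - v0 t| <= C * (`|lambda - lambda0| + `|u a - u0 a|).
Proof.
move=> sol0; have [M0 M00 qM0] := potential_bound lambda0.
have [U U0 u0U] := cont_on_bounded tsS (sl_pair_value_cont sol0).
pose M := M0 + 1; have Mgt0 : 0 < M by rewrite /M; lra.
pose L := 2 * M * (b - a); have L0 : 0 < L by rewrite !mulr_gt0// subr_gt0.
exists (2 * ((M + U) / L) * weight L m).
  by rewrite !mulr_gt0 ?weight_gt0 ?invr_gt0 ?addr_gt0.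
move=> lambda u v ll0 sol va t Kt.
set dl := `|lambda - lambda0|; set du := `|u a - u0 a|.
have dl0 : 0 <= dl := normr_ge0 _; have du0 : 0 <= du := normr_ge0 _.
have vc := sl_pair_slope_cont sol; have v0c := sl_pair_slope_cont sol0.
have wc : cont_on K (fun s => v s - v0 s) by move=> s Ks; apply: cvgB; [exact: vc|exact: v0c].
have beta0 : 0 <= dl * U by rewrite mulr_ge0// ltW.
have [B B0 wB] := cont_on_bounded tsK wc.
pose c := (M * du + dl * U) / L.
have step A : (forall s, K s -> `|v s - v0 s| <= A * weight L s) ->
    forall s, K s -> `|v s - v0 s| <= (A / 2 + c) * weight L s.
  move=> wA s Ks.
  have H := @weighted_contraction (fun s => u s - u0 s) (fun s => v s - v0 s)
    (fun s => v s - v0 s)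
    (fun s => - (q s + lambda) * u (sigma K s) - - (q s + lambda0) * u0 (sigma K s))
    A M (dl * U) L.
  have {}H := H _ _ wc wA _ L0 (lexx _) (ltW Mgt0) beta0 s Ks.
  rewrite /= va subrr subr0 -/du -/c in H; apply: H.
  - by move=> x Kx; apply: delta_derivB; [exact: sol.1|exact: sol0.1].
  - move=> x Kx xm; have KKx := kappa_lt kK Kx xm.
    by apply: delta_derivB; [exact: sol.2|exact: sol0.2].
  - move=> x Kx _; have Sx := KS Kx.
    have -> : - (q x + lambda) * u (sigma K x) - - (q x + lambda0) * u0 (sigma K x)
       = - (q x + lambda) * (u (sigma K x) - u0 (sigma K x))
         - (lambda - lambda0) * u0 (sigma K x) by ring.
    apply: le_trans (ler_normB _ _) _; rewrite !normrM normrN; apply: lerD.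
      apply: ler_wpM2r => //; have := qM0 x Sx; have := ler_normD (q x + lambda0) (lambda - lambda0).
      have -> : q x + lambda0 + (lambda - lambda0) = q x + lambda by ring.
      by rewrite /M; lra.
    apply: ler_wpM2l => //; apply: u0U; apply: KS; exact: (sigma_kappa_in kS).
(* Iterating [A -> A / 2 + c] drives any initial bound down to [2 * c]. *)
have iter n s : K s -> `|v s - v0 s| <= (B / 2 ^+ n + 2 * c) * weight L s.
  elim: n s => [|n IHn] s Ks.
    rewrite expr0 divr1; apply: le_trans (wB s Ks) _.
    have c0 : 0 <= 2 * c by rewrite mulr_ge0// divr_ge0 ?(ltW L0)// addr_ge0// mulr_ge0// ltW.
    apply: le_trans (_ : B + 2 * c <= _); first by rewrite lerDl.
    rewrite ler_peMr ?addr_ge0 ?(ltW B0)//; apply: weight_ge1; first exact: ltW.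
    by have /andP[] := Kam Ks.
  have := step _ IHn s Ks; congr (_ <= _ * _).
  by rewrite exprSr; field; rewrite expf_neq0// pnatr_eq0.
have wt0 : 0 < weight L t := weight_gt0 L t.
have H : `|v t - v0 t| <= 2 * c * weight L t.
  apply/ler_addgt0Pr => d d0; have [n nP] := half_pow_small (B * weight L t) d0.
  have := iter n t Kt; rewrite mulrDl mulrAC; lra.
apply: le_trans H _.
have tm : weight L t <= weight L m.
  by apply: weight_le; [exact: ltW|have /andP[] := Kam Kt].
have cle : c <= (M + U) / L * (dl + du).
  rewrite /c mulrAC ler_wpM2r ?invr_ge0 ?(ltW L0)//.
  have := mulr_ge0 (ltW Mgt0) dl0; have := mulr_ge0 (ltW U0) du0; lra.
have c0 : 0 <= c by rewrite divr_ge0 ?(ltW L0)// addr_ge0// mulr_ge0// ltW.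
apply: le_trans (_ : 2 * c * weight L m <= _).
  by rewrite ler_wpM2l// mulr_ge0.
have := ler_wpM2r (ltW (weight_gt0 L m)) cle; lra.
Qed.

(** Near [a] the slope is at least [1 / 2]; away from [a] compactness provides a
    positive minimum. A lower bound of this form, unlike a constant one, is
    compatible with the zero at [a] and survives perturbation. *)
Lemma dirichlet_lower_bound (u v : R -> R) : cont_on S u -> cont_on K v ->
  (forall t, K t -> is_delta_deriv S u t (v t)) -> u a = 0 -> v a = 1 ->
  (forall t, S t -> a < t -> 0 < u t) ->
  exists2 c, 0 < c & forall t, S t -> c * (t - a) <= u t.
Proof.
move=> uc vc uv ua va upos; have h0 : (0 : R) < 1 / 2 by lra.
have /cvg_withinP/(_ _ h0)[r r0 rP] := vc a Ka.
pose d := Num.min r (b - a); have d0 : 0 < d by rewrite lt_min r0 subr_gt0.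
have dr : d <= r by rewrite ge_min lexx.
have db : d <= b - a by rewrite ge_min lexx orbT.
pose A := S `&` [set` `[a + d, b]].
have Ac : compact A.
  apply: (subclosed_compact _ (@segment_compact R (a + d) b)); last by move=> t [].
  apply: closedI; [by case: tsS|exact: interval_closed].
have Ab : A b by split=> //=; rewrite in_itv/= lexx andbT; lra.
have uA : {within A, continuous u}.
  apply/subspace_continuousP => t [St At].
  by apply: cvg_withinS (uc t St) => s [].
have [t0 t0A t0min] := compact_EVT_min (ex_intro _ b Ab) Ac uA.
move: t0A; rewrite inE => -[St0 /=]; rewrite in_itv/= => /andP[at0 _].
have u00 : 0 < u t0 by apply: upos => //; lra.
have ba0 : 0 < b - a by rewrite subr_gt0.
exists (Num.min (1 / 2) (u t0 / (b - a))); first by rewrite lt_min h0 divr_gt0.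
move=> t St; have /andP[at_ tb] := Sab St.
have [td|dt] := leP t (a + d); last first.
  apply: le_trans (_ : u t0 <= _); last first.
    by apply: t0min; rewrite inE; split=> //=; rewrite in_itv/= (ltW dt).
  apply: le_trans (_ : u t0 / (b - a) * (t - a) <= _).
    by rewrite ler_wpM2r ?subr_ge0// ge_min lexx orbT.
  rewrite mulrAC ler_pdivrMr// ler_wpM2l ?(ltW u00)//; lra.
apply: le_trans (_ : 1 / 2 * (t - a) <= _).
  by rewrite ler_wpM2r ?subr_ge0// ge_min lexx.
have := @delta_deriv_ge R S a b u v (1 / 2) a t tsS Sa St at_ uc; rewrite ua subr0; apply.
  by move=> x Sx /andP[_ xt]; apply: uv; exact: (kappa_lt_trans kS Sx St).
move=> x Sx /andP[ax xt]; have Kx := kappa_lt_trans kS Sx St xt.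
have xr : `|x - a| < r by rewrite ger0_norm ?subr_ge0//; lra.
by have := rP x Kx xr; rewrite va ler_norml => /andP[? _]; lra.
Qed.

(** Slopes of nearby solutions are uniformly close, so such a solution differs from
    [u0 + e] by a small multiple of [t - a], which the previous lower bound
    absorbs. With [e = 0] this says that positivity is an open condition on
    [lambda]; with [e > 0] it provides solutions positive on all of [S]. *)
Lemma positive_stable lambda0 u0 v0 : sl_pair S q lambda0 u0 v0 ->
  u0 a = 0 -> v0 a = 1 -> (forall t, S t -> a < t -> 0 < u0 t) ->
  exists2 d, 0 < d & forall lambda e u v, `|lambda - lambda0| <= d -> 0 <= e <= d ->
    sl_pair S q lambda u v -> u a = e -> v a = 1 ->
    forall t, S t -> a < t -> 0 < u t.
Proof.
move=> sol0 u0a v0a pos0.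
have u0c := sl_pair_value_cont sol0; have v0c := sl_pair_slope_cont sol0.
have [C C0 dep] := sl_pair_dependence sol0.
have [c c0 cP] := dirichlet_lower_bound u0c v0c sol0.1 u0a v0a pos0.
have d0 : 0 < c / (4 * C) by rewrite divr_gt0// mulr_gt0.
(* The slopes are then at most [C * (2 * d) <= c / 2] apart. *)
exists (Num.min 1 (c / (4 * C))); first by rewrite lt_min ltr01.
move=> lambda e u v; rewrite le_min => /andP[l1 l2].
rewrite le_min => /and3P[e0 _ e2] sol ua va t St at_.
have uc := sl_pair_value_cont sol.
have := @delta_deriv_ge R S a b (fun s => u s - u0 s) (fun s => v s - v0 s) (- (c / 2)) a t
  tsS Sa St (ltW at_).
rewrite ua u0a subr0 => H.
have ta : 0 < t - a by rewrite subr_gt0.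
suff : - (c / 2) * (t - a) <= u t - u0 t - e.
  have := cP t St; have := mulr_gt0 c0 ta; lra.
apply: H.
- by move=> s Ss; apply: cvgB; [exact: uc|exact: u0c].
- move=> s Ss /andP[_ st]; have Ks := kappa_lt_trans kS Ss St st.
  by apply: delta_derivB; [exact: sol.1|exact: sol0.1].
- move=> s Ss /andP[_ st]; have Ks := kappa_lt_trans kS Ss St st.
  have := dep lambda u v l1 sol; rewrite va v0a => /(_ erefl s Ks).
  rewrite ua u0a subr0 (ger0_norm e0) ler_norml => /andP[H1 _].
  have H2 : C * (`|lambda - lambda0| + e) <= C * (2 * (c / (4 * C))).
    by rewrite ler_pM2l//; lra.
  have E : C * (2 * (c / (4 * C))) = c / 2 by field; rewrite gt_eqF.
  by rewrite E in H2; lra.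
Qed.

(** * Zeros of nonnegative solutions *)

Lemma wronskian_const lambda u v x y :
  sl_pair S q lambda u v -> sl_pair S q lambda x y ->
  forall t, K t -> x t * v t - u t * y t = x a * v a - u a * y a.
Proof.
move=> uv xy t Kt.
have toK f : cont_on S f -> cont_on K f.
  by move=> fc s Ks; apply: cvg_withinS (fc s (KS Ks)); exact: kappa_sub.
have uc := toK _ (sl_pair_value_cont uv); have xc := toK _ (sl_pair_value_cont xy).
have vc := sl_pair_slope_cont uv; have yc := sl_pair_slope_cont xy.
apply: (delta_deriv0_const (f := fun t => x t * v t - u t * y t) tsK) => //.
  by move=> s Ks; apply: cvgB; apply: cvgM; [exact: xc|exact: vc|exact: uc|exact: yc].
move=> s Ks sm; have KKs := kappa_lt kK Ks sm.
have toKd f d : is_delta_deriv S f s d -> is_delta_deriv K f s d.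
  by apply: delta_deriv_sub; [exact: kappa_sub|exact: (sigma_kappa kS)].
have := delta_derivB (delta_derivM Ks (toKd _ _ (xy.1 s Ks)) (uv.2 s KKs))
  (delta_derivM Ks (toKd _ _ (uv.1 s Ks)) (xy.2 s KKs)).
by congr (is_delta_deriv _ _ _ _); ring.
Qed.

(** At an interior zero the slope would vanish as well, since the solution
    cannot change sign; the Wronskian with a second solution excludes this. *)
Lemma no_interior_zero lambda u v t : sl_pair S q lambda u v ->
  u a = 0 -> v a = 1 -> (forall s, S s -> 0 <= u s) ->
  S t -> a < t < b -> u t <> 0.
Proof.
move=> uv ua va u0 St /andP[at_ tb] ut.
have Kt := kappa_lt kS St tb; have /andP[_ tm] := Kam Kt.
have uc := sl_pair_value_cont uv; have vc := sl_pair_slope_cont uv.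
(* A negative slope at [t] would make [u] negative just after [t]. *)
have vt_ge0 : 0 <= v t.
  rewrite leNgt; apply/negP => vt0; have e0 : 0 < - v t / 2 by lra.
  have [s [Ss ts sP]] := delta_deriv_right St tsS tb (uv.1 t Kt) e0.
  have := sP s Ss; rewrite ts lexx => /(_ isT); rewrite ut ler_norml => /andP[_ H].
  have := u0 s Ss; have : 0 < - v t * (s - t) by rewrite mulr_gt0 ?oppr_gt0 ?subr_gt0.
  lra.
(* For the other sign, look at the last point before [t]: if there is none, a
   positive slope near [t] would make [u] negative on the left; otherwise the
   equation at that point [p] gives [v p = v t], because [u t = 0], while [u]
   cannot increase from [p] to [t]. *)
have vt_le0 : v t <= 0.
  have tsSt : compact_ts (S `&` [set` `]-oo, t]]) a t.
    split.
    - by apply: closedI; [case: tsS|exact: interval_closed].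
    - by split=> //=; rewrite in_itv/= ltW.
    - by split=> //=; rewrite in_itv/= lexx.
    - by move=> s [Ss /=]; rewrite in_itv/= => ->; have /andP[->] := Sab Ss.
  have [p kSt] := kappa_ts_exists tsSt at_.
  rewrite leNgt; apply/negP => vt0.
  case: (kappa_ts_last kSt) => [[pt adh]|pt].
    have e0 : 0 < v t / 2 by lra.
    have /cvg_withinP/(_ _ e0)[r r0 rP] := vc t Kt.
    have [s [[Ss _] st sr]] := adh r r0.
    have := @delta_deriv_ge R S a b u v (v t / 2) s t tsS Ss St (ltW st) uc; rewrite ut.
    have : 0 < v t / 2 * (t - s) by rewrite mulr_gt0// subr_gt0.
    have := u0 s Ss => us0 H1 H2; suff : v t / 2 * (t - s) <= 0 - u s by lra.
    apply: H2.
      by move=> x Sx /andP[_ xt]; apply: uv.1; exact: (kappa_lt_trans kS Sx St).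
    move=> x Sx /andP[sx xt]; have Kx := kappa_lt_trans kS Sx St xt.
    have : `|x - t| < r by rewrite ltr0_norm ?subr_lt0//; lra.
    by move=> /(rP x Kx); rewrite ler_norml => /andP[? _]; lra.
  have [Sp _] := kappa_sub (kappa_in_max kSt).
  have Kp := kappa_lt_trans kS Sp St pt; have pm := lt_le_trans pt tm.
  have sp : sigma S p = t.
    have := sigma_le tsS St pt; rewrite le_eqVlt => /predU1P[//|spt].
    have pb := ltW (lt_trans pt tb).
    have Ssp : (S `&` [set` `]-oo, t]]) (sigma S p).
      by split; [exact: (sigma_in tsS pb)|rewrite /= in_itv/= ltW].
    have spp : sigma S p = p.
      apply/eqP; rewrite eq_le (sigma_ge tsS pb) andbT.
      exact: (kappa_ts_max kSt Ssp spt).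
    have e0 : 0 < t - p by rewrite subr_gt0.
    have [s [Ss ps]] := sigma_adherent tsS (lt_trans pt tb) e0.
    rewrite spp addrC subrK => st.
    have : s <= p by apply: (kappa_ts_max kSt) => //; split=> //=; rewrite in_itv/= ltW.
    by rewrite leNgt ps.
  have := delta_deriv_jump Sp (uv.1 p Kp); rewrite sp ut => Hu.
  have := delta_deriv_jump Kp (uv.2 p (kappa_lt kK Kp pm)).
  rewrite (sigma_kappa kS pm) sp ut mulr0 mul0r => /subr0_eq Hv.
  have := u0 p Sp; have : 0 < v p * (t - p) by rewrite mulr_gt0 ?subr_gt0// -Hv.
  lra.
have vt : v t = 0 by apply/eqP; rewrite eq_le vt_le0.
have [x [y [xy xa ya _]]] := ivp_exists lambda 1 0.
have := wronskian_const uv xy Kt; rewrite ut vt ua va xa ya.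
by rewrite !mulr0 !mul0r mul1r subrr subr0 => /eqP; rewrite eq_sym oner_eq0.
Qed.

(** * The quadratic functional *)

Lemma square_antiderivative (p y : R -> R) : cont_on K p -> cont_on S y ->
  antiderivative S (fun t => p t * y (sigma S t) ^+ 2)
    (upper_integral S a (fun t => p t * y (sigma S t) ^+ 2)).
Proof.
move=> pc yc; have [P P0 pP] := cont_on_bounded tsK pc.
have [Y Y0 yY] := cont_on_bounded tsS yc.
have Ssig t : S t -> S (sigma S t) by move=> /Sab/andP[_ tb]; exact: (sigma_in tsS tb).
apply: (antiderivative_upper_integral kS (B := P * Y ^+ 2)) => [t Kt|t Kt tt].
  rewrite normrM normrX; apply: ler_pM => //; first exact: pP.
  by rewrite lerXn2r ?nnegrE ?(ltW Y0)//; apply: yY; apply: Ssig; exact: KS.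
have yt : y (sigma S s) @[s --> within K (nbhs t)] --> y t.
  apply/cvg_withinP => e e0; have /cvg_withinP/(_ e e0)[r r0 rP] := yc t (KS Kt).
  have r20 : 0 < r / 2 by lra.
  have /cvg_withinP/(_ _ r20)[d d0 dP] := sigma_cvg tsS (KS Kt) tt.
  exists d => // s /KS Ss sd; apply: rP; first exact: Ssig.
  by apply: le_lt_trans (dP s Ss sd) _; lra.
rewrite tt; apply: cvgM; first exact: pc.
by rewrite expr2; under eq_fun do rewrite expr2; apply: cvgM.
Qed.

Lemma energy_antiderivative (y z : R -> R) : cont_on S y -> cont_on K z ->
  exists F, antiderivative S (fun t => z t ^+ 2 - q t * y (sigma S t) ^+ 2) F.
Proof.
move=> yc zc; have [Z Z0 zZ] := cont_on_bounded tsK zc.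
have z2c : cont_on K (fun t => z t ^+ 2).
  move=> t Kt; rewrite expr2; under eq_fun do rewrite expr2.
  by apply: cvgM; exact: zc.
have z2Z t : K t -> `|z t ^+ 2| <= Z ^+ 2.
  by move=> Kt; rewrite normrX lerXn2r ?nnegrE ?(ltW Z0)// zZ.
have Kqc : cont_on K q.
  by move=> t Kt; apply: cvg_withinS (qc (KS Kt)); exact: kappa_sub.
have Fz := antiderivative_upper_integral kS z2Z (fun t Kt _ => z2c t Kt).
have Fy := square_antiderivative Kqc yc.
exists (fun t => upper_integral S a (fun t => z t ^+ 2) t
  - upper_integral S a (fun t => q t * y (sigma S t) ^+ 2) t).
by move=> t Kt; apply: delta_derivB; [exact: Fz|exact: Fy].
Qed.

Lemma shift_square_antiderivative (y : R -> R) : cont_on S y ->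
  exists H, antiderivative S (fun t => y (sigma S t) ^+ 2) H.
Proof.
move=> yc; have c1 : cont_on K (fun=> 1) by move=> t _; exact: cvg_cst.
have := square_antiderivative c1 yc.
have -> : (fun t => 1 * y (sigma S t) ^+ 2) = (fun t => y (sigma S t) ^+ 2).
  by apply/funext => t; rewrite mul1r.
by move=> ?; exists (upper_integral S a (fun t => y (sigma S t) ^+ 2)).
Qed.

Section energy.
Variables (lambda : R) (y z F H : R -> R).
Hypotheses (yz : forall t, K t -> is_delta_deriv S y t (z t)).
Hypotheses (ya : y a = 0) (yb : y b = 0).
Hypothesis FP : antiderivative S (fun t => z t ^+ 2 - q t * y (sigma S t) ^+ 2) F.
Hypothesis HP : antiderivative S (fun t => y (sigma S t) ^+ 2) H.

Let restrict_deriv t f d : t < m -> is_delta_deriv S f t d -> is_delta_deriv K f t d.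
Proof.
by move=> tm; apply: delta_deriv_sub; [exact: kappa_sub|exact: (sigma_kappa kS)].
Qed.

Let cont_kappa f : cont_on S f -> cont_on K f.
Proof. by move=> fc t Kt; apply: cvg_withinS (fc t (KS Kt)); exact: kappa_sub. Qed.

Let yc : cont_on K y := cont_kappa (delta_deriv_cont_on kS yz).
Let Fc : cont_on K F.
Proof. by apply: cont_kappa; apply: (delta_deriv_cont_on kS); exact: FP. Qed.
Let Hc : cont_on K H.
Proof. by apply: cont_kappa; apply: (delta_deriv_cont_on kS); exact: HP. Qed.

(** If [b] is left-scattered, the gap after [m] contributes only through the
    derivative of [y] at [m], because [y b = 0]. *)
Let last_gap : m < b ->
  F b - lambda * H b = F m - lambda * H m + z m ^+ 2 * (b - m) /\
  y m = - z m * (b - m).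
Proof.
move=> mltb; have Sm := KS Km.
have := delta_deriv_jump Sm (FP Km); have := delta_deriv_jump Sm (HP Km).
have := delta_deriv_jump Sm (yz Km); rewrite (sigma_last kS mltb) yb.
rewrite expr0n/= !mulr0 !mul0r !subr0 => H1 H2 H3; split; last lra.
by rewrite (subr0_eq H2); lra.
Qed.

(** Integration by parts: [y z] vanishes at both ends and its derivative is the
    integrand of the functional at [lambda]. *)
Lemma energy_eigen : sl_pair S q lambda y z -> F b - F a = lambda * (H b - H a).
Proof.
move=> sol; have zc := sl_pair_slope_cont sol.
pose D t := F t - lambda * H t - y t * z t.
have Dc : cont_on K D.
  move=> t Kt; apply: cvgB; last by apply: cvgM; [exact: yc|exact: zc].
  by apply: cvgB; [exact: Fc|apply: cvgM; [exact: cvg_cst|exact: Hc]].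
have Dm : D m = D a.
  apply: (delta_deriv0_const tsK Dc) => // t Kt tm; have St := KS Kt.
  have := delta_derivB (delta_derivB (restrict_deriv tm (FP Kt))
    (delta_derivZ lambda (restrict_deriv tm (HP Kt))))
    (delta_derivM Kt (restrict_deriv tm (yz Kt)) (sol.2 t (kappa_lt kK Kt tm))).
  by rewrite (sigma_kappa kS tm); congr (is_delta_deriv _ _ _ _); ring.
move: Dm; rewrite /D ya mul0r subr0 => Dm.
case: (kappa_ts_last kS) => [[mb' _]|mltb].
  by move: Dm; rewrite mb' yb mul0r; lra.
have [FH ym] := last_gap mltb; rewrite ym in Dm; lra.
Qed.

(** Picone's identity: against a positive solution [u], the integrand of the
    functional at [lambda] exceeds the derivative of [y ^+ 2 * v / u] by the
    square of [z u - y v], divided by [u u^sigma]. *)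
Lemma energy_picone u v : sl_pair S q lambda u v -> (forall t, S t -> 0 < u t) ->
  lambda * (H b - H a) <= F b - F a.
Proof.
move=> sol upos; have vc := sl_pair_slope_cont sol.
have uc := cont_kappa (sl_pair_value_cont sol).
have u0 t : K t -> u t != 0 by move=> Kt; rewrite gt_eqF// upos//; exact: KS.
pose D t := F t - lambda * H t - y t * y t * ((u t)^-1 * v t).
pose d t := (z t * u t - y t * v t) ^+ 2 / (u t * u (sigma S t)).
have Dc : cont_on K D.
  move=> t Kt; apply: cvgB; last first.
    apply: cvgM; first by apply: cvgM; exact: yc.
    by apply: cvgM; [apply: cvgV; [exact: u0|exact: uc]|exact: vc].
  by apply: cvgB; [exact: Fc|apply: cvgM; [exact: cvg_cst|exact: Hc]].
have Dd t : K t -> t < m -> is_delta_deriv K D t (d t).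
  move=> Kt tm; have St := KS Kt; have Kst := sigma_kappa_in kS Kt.
  have yj := delta_deriv_jump St (yz Kt); have uj := delta_deriv_jump St (sol.1 t Kt).
  have uK := restrict_deriv tm (sol.1 t Kt); have yK := restrict_deriv tm (yz Kt).
  have uVv := delta_derivM Kt (delta_derivV Kt u0 Kst uK) (sol.2 t (kappa_lt kK Kt tm)).
  have := delta_derivB (delta_derivB (restrict_deriv tm (FP Kt))
    (delta_derivZ lambda (restrict_deriv tm (HP Kt))))
    (delta_derivM Kt (delta_derivM Kt yK yK) uVv).
  have us0 : u (sigma S t) != 0 by rewrite -(sigma_kappa kS tm) u0.
  rewrite (sigma_kappa kS tm); congr (is_delta_deriv _ _ _ _).
  have ys : y (sigma S t) = y t + z t * (sigma S t - t) by lra.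
  have us : u (sigma S t) = u t + v t * (sigma S t - t) by lra.
  rewrite /d ys us in us0 *; field.
  by rewrite us0 u0.
have Dle : D a <= D m.
  have := @delta_deriv_ge R K a m D d 0 a m tsK Ka Km (ltW am) Dc.
  rewrite mul0r subr_ge0; apply=> t Kt /andP[_ tm]; first exact: Dd.
  rewrite /d divr_ge0 ?sqr_ge0// mulr_ge0// ltW// upos//; first exact: KS.
  by rewrite -(sigma_kappa kS tm); apply: KS; exact: (sigma_kappa_in kS).
move: Dle; rewrite /D ya !mul0r subr0 => Dle.
case: (kappa_ts_last kS) => [[mb' _]|mltb].
  by move: Dle; rewrite mb' yb !mul0r; lra.
have [FH ym] := last_gap mltb.
have uj := delta_deriv_jump (KS Km) (sol.1 m Km); rewrite (sigma_last kS mltb) in uj.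
have gap : 0 <= z m ^+ 2 * (b - m) * (u b / u m).
  apply: mulr_ge0; last by apply: divr_ge0; apply/ltW/upos => //; exact: KS.
  by rewrite mulr_ge0 ?sqr_ge0// subr_ge0 ltW.
have E : z m ^+ 2 * (b - m) * (u b / u m)
    = z m ^+ 2 * (b - m) + y m * y m * ((u m)^-1 * v m).
  have -> : u b = u m + v m * (b - m) by lra.
  by rewrite ym; field; rewrite u0.
rewrite E in gap; lra.
Qed.

End energy.

(** * The first eigenvalue *)

Definition dirichlet_positive (lambda : R) : Prop := exists u v,
  [/\ sl_pair S q lambda u v, u a = 0, v a = 1 &
      forall t, S t -> a < t -> 0 < u t].

(** For [lambda] at most [- q] everywhere, the slope stays at least [1]. *)
Lemma dirichlet_positive_exists : exists lambda, dirichlet_positive lambda.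
Proof.
have [Q Q0 qQ] := cont_on_bounded tsS qc.
have [u [v [sol ua va v1]]] := ivp_exists (- Q) 0 1; exists (- Q), u, v.
split=> // t St at_.
have q0 x : S x -> q x + - Q <= 0.
  by move=> /qQ; rewrite ler_norml => /andP[_]; lra.
have {}v1 := v1 (lexx 0) ler01 q0.
have := @delta_deriv_ge R S a b u v 1 a t tsS Sa St (ltW at_) (sl_pair_value_cont sol).
rewrite ua subr0 mul1r => ut; apply: lt_le_trans (_ : t - a <= _).
  by rewrite subr_gt0.
apply: ut => s Ss /andP[_ st]; have Ks := kappa_lt_trans kS Ss St st.
  exact: sol.1.
exact: v1.
Qed.

(** Picone's identity is applied to a solution with a small positive initial value,
    which avoids the singularity of [v / u] at [a]. *)
Lemma dirichlet_positive_energy lambda (y z F H : R -> R) :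
  dirichlet_positive lambda ->
  (forall t, K t -> is_delta_deriv S y t (z t)) -> y a = 0 -> y b = 0 ->
  antiderivative S (fun t => z t ^+ 2 - q t * y (sigma S t) ^+ 2) F ->
  antiderivative S (fun t => y (sigma S t) ^+ 2) H ->
  lambda * (H b - H a) <= F b - F a.
Proof.
move=> [u0 [v0 [sol0 u0a v0a pos0]]] yz ya yb FP HP.
have [d d0 dP] := positive_stable sol0 u0a v0a pos0.
have [u [v [sol ua va _]]] := ivp_exists lambda d 1.
apply: (energy_picone yz ya yb FP HP sol) => t St.
have /andP[] := Sab St; rewrite le_eqVlt => /predU1P[<- _|at_ _]; first by rewrite ua.
apply: (dP lambda d u v) => //; first by rewrite subrr normr0 ltW.
by rewrite lexx ltW.
Qed.

(** The supremum of the parameters whose solution stays positive is an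
    eigenvalue: there positivity fails for the first time, and it can only fail
    at [b]. *)
Lemma dirichlet_positive_sup : has_sup dirichlet_positive ->
  exists u v, [/\ sl_pair S q (sup dirichlet_positive) u v, u a = 0, u b = 0 & v a = 1].
Proof.
move=> supP; set l := sup _.
have [u [v [sol ua va _]]] := ivp_exists l 0 1; exists u, v; split=> //.
have ltl lambda : dirichlet_positive lambda -> lambda <= l.
  by move=> pl; apply: ub_le_sup => //; exact: supP.2.
have [C C0 dep] := sl_pair_dependence sol.
have uc := sl_pair_value_cont sol.
have u0 t : S t -> 0 <= u t.
  move=> St; have /andP[at_ tb] := Sab St; apply/ler_addgt0Pr => e e0.
  have ba0 : 0 < b - a by rewrite subr_gt0.
  have d0 : 0 < Num.min 1 (e / (C * (b - a))) by rewrite lt_min ltr01 divr_gt0// mulr_gt0.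
  have [k [w [x [solk wa xa wpos]]] lk] := sup_adherent d0 supP.
  rewrite -/l in lk; have kl := ltl k (ex_intro _ w (ex_intro _ x (And4 solk wa xa wpos))).
  have wt : 0 <= w t.
    by move: at_; rewrite le_eqVlt => /predU1P[<-|/(wpos t St)/ltW//]; rewrite wa.
  have : `|k - l| < Num.min 1 (e / (C * (b - a))).
    by rewrite ler0_norm ?subr_le0//; lra.
  rewrite lt_min => /andP[k1 k2].
  have := @delta_deriv_ge R S a b (fun s => u s - w s) (fun s => v s - x s) (- (C * `|k - l|))
    a t tsS Sa St at_.
  rewrite ua wa subrr subr0 => Hd.
  have : - (C * `|k - l|) * (t - a) <= u t - w t.
    apply: Hd.
    - by move=> s Ss; apply: cvgB; [exact: uc|exact: (sl_pair_value_cont solk)].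
    - move=> s Ss /andP[_ st]; have Ks := kappa_lt_trans kS Ss St st.
      by apply: delta_derivB; [exact: sol.1|exact: solk.1].
    - move=> s Ss /andP[_ st]; have Ks := kappa_lt_trans kS Ss St st.
      have := dep k w x (ltW k1) solk; rewrite xa va => /(_ erefl s Ks).
      by rewrite wa ua subrr normr0 addr0 ler_norml => /andP[_]; lra.
  have : C * `|k - l| * (t - a) <= C * `|k - l| * (b - a).
    by rewrite ler_wpM2l ?lerD2r// mulr_ge0// ltW.
  have : C * `|k - l| * (b - a) <= e.
    by move: k2; rewrite ltr_pdivlMr ?mulr_gt0// => /ltW; rewrite mulrA [_ * C]mulrC.
  lra.
have notP : ~ (forall t, S t -> a < t -> 0 < u t).
  move=> upos; have [d d0 dP] := positive_stable sol ua va upos.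
  have [u' [v' [sol' ua' va' _]]] := ivp_exists (l + d) 0 1.
  suff /ltl : dirichlet_positive (l + d) by lra.
  exists u', v'; split=> // t St at_; apply: (dP (l + d) 0 u' v') => //.
    by rewrite addrC addKr gtr0_norm.
  by rewrite lexx ltW.
have [t [St at_ ut]] : exists t, [/\ S t, a < t & u t = 0].
  apply: contrapT => nex; apply: notP => t St at_; rewrite lt_neqAle u0// andbT.
  by apply/eqP => ut; apply: nex; exists t.
have /andP[_] := Sab St; rewrite le_eqVlt => /predU1P[<-//|tb].
by have := no_interior_zero sol ua va u0 St; rewrite at_ tb => /(_ isT).
Qed.

(** * Solutions in terms of the delta derivative operator *)

Lemma sl_pair_solution lambda u v : sl_pair S q lambda u v -> SL_solution S q lambda u.
Proof.
move=> [uv vf].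
have uE t : K t -> v t = delta_deriv S u t.
  move=> Kt; apply: (delta_deriv_uniq kS ab Kt (uv t Kt)).
  by apply: xgetPex; exists (v t); exact: uv.
have vK t : kappa K t -> is_delta_deriv K (delta_deriv S u) t
    (- (q t + lambda) * u (sigma K t)).
  move=> Kt; apply: (delta_deriv_ext uE); last exact: vf.
  by apply: (sigma_kappa_in kS); exact: kappa_sub.
split; first split=> t Kt.
- by exists (v t); exact: uv.
- by exists (- (q t + lambda) * u (sigma K t)); exact: vK.
- move=> t Kt; suff -> : delta_deriv2 S u t = - (q t + lambda) * u (sigma K t) by ring.
  apply: (delta_deriv_uniq kK am Kt _ (vK t Kt)).
  by apply: xgetPex; exists (- (q t + lambda) * u (sigma K t)); exact: vK.
Qed.

Lemma solution_sl_pair lambda y : SL_solution S q lambda y ->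
  sl_pair S q lambda y (delta_deriv S y).
Proof.
move=> [[y1 y2] ysol]; split=> t Kt.
  by apply: xgetPex; exact: y1.
have -> : - (q t + lambda) * y (sigma K t) = delta_deriv2 S y t.
  by have := ysol t Kt; lra.
by apply: xgetPex; exact: y2.
Qed.

(** The equation expresses the second derivative through [q], [y] and the jump
    operator of [K], and the last of these is the only source of discontinuity: it
    is continuous at right-dense points and has left limits everywhere. *)
Lemma solution_C2rd lambda y : SL_solution S q lambda y -> C2rd S y.
Proof.
move=> sol; have yc := sl_pair_value_cont (solution_sl_pair sol).
case: sol => y12 ysol; split=> //.
have yE t : kappa K t -> delta_deriv2 S y t = - (q t + lambda) * y (sigma K t).
  by move=> /ysol; lra.
have lim (A : set R) t : A `<=` kappa K -> kappa K t ->
    sigma K s @[s --> within A (nbhs t)] --> t ->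
    delta_deriv2 S y s @[s --> within A (nbhs t)] --> - (q t + lambda) * y t.
  move=> AK Kt st; have AK' s : A s -> K s by move=> /AK; exact: kappa_sub.
  have /cvg_withinP H := shift_cvg (lambda := lambda) yc (kappa_sub Kt) AK' st.
  apply/cvg_withinP => e /H[r r0 rP]; exists r => // s As.
  by rewrite (yE s (AK s As)); exact: rP.
split=> t Kt tt; have Kt' := kappa_sub Kt.
- have ss : sigma K t = t.
    have /andP[_] := Kam Kt'; rewrite le_eqVlt => /predU1P[->|tm].
      exact: (sigma_kappa_max kS).
    by rewrite (sigma_kappa kS tm).
  rewrite yE// ss; apply: lim => //.
  by apply: cvg_withinS (sigma_cvg tsK Kt' ss); exact: kappa_sub.
- exists (- (q t + lambda) * y t); apply: lim => [s []//|//|].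
  by apply: cvg_withinS (sigma_cvg_left tsK Kt') => s [/kappa_sub Ks st]; split.
Qed.

End sturm_liouville.

Theorem theorem3p7 (R : realType) (T : set R) (a b : R) (q : R -> R)
    (lambda1 : R) (y1 : R -> R) :
  time_scale T -> T a -> T b -> a < b ->
  {within ts_itv T a b, continuous q} ->
  first_eigenvalue (ts_itv T a b) a b q lambda1 ->
  sl_eigenfunction (ts_itv T a b) a b q lambda1 y1 ->
  normalized (ts_itv T a b) a b y1 ->
  [/\ admissible (ts_itv T a b) a b y1,
      forall y : R -> R, admissible (ts_itv T a b) a b y ->
        J (ts_itv T a b) a b q y1 <= J (ts_itv T a b) a b q y
    & J (ts_itv T a b) a b q y1 = lambda1].
Proof.
move=> [cT _] Ta Tb ab /subspace_continuousP qc [_ lambda1_min].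
move=> [sol1 y1a y1b [t [St y1t]]] norm1; set S := ts_itv T a b in qc *.
have tsS : compact_ts S a b by apply: compact_ts_itv => //; exact: ltW.
have [m kS] := kappa_ts_exists tsS ab.
(* A nontrivial function that vanishes at both ends needs an interior point. *)
have am : a < m.
  have /andP[at_ tb] := kappa_ts_le kS St.
  apply: lt_le_trans (kappa_ts_max kS St _); rewrite lt_neqAle ?at_ ?tb andbT.
    by apply/eqP => ta; apply: y1t; rewrite -ta.
  by apply/eqP => ta; apply: y1t; rewrite ta.
have [m' kK] := kappa_ts_exists (kappa_ts_kappa kS) am.
have energy y : admissible S a b y -> exists F H,
    [/\ antiderivative S (fun t => delta_deriv S y t ^+ 2 - q t * y (sigma S t) ^+ 2) F,
        antiderivative S (fun t => y (sigma S t) ^+ 2) H,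
        J S a b q y = F b - F a & H b - H a = 1].
  move=> [[[yd1 yd2] _] ya yb yn].
  have yz t' : kappa S t' -> is_delta_deriv S y t' (delta_deriv S y t').
    by move=> Kt; apply: xgetPex; exact: yd1.
  have yc := delta_deriv_cont_on kS yz.
  have zc : cont_on (kappa S) (delta_deriv S y).
    apply: (delta_deriv_cont_on (d := delta_deriv2 S y) kK) => t' Kt.
    by apply: xgetPex; exact: yd2.
  have [F FP] := energy_antiderivative kS qc yc zc.
  have [H HP] := shift_square_antiderivative kS yc.
  exists F, H; split=> //; first exact: (delta_integralE kS FP).
  by rewrite -(delta_integralE kS HP).
have adm1 : admissible S a b y1 by split=> //; exact: (solution_C2rd kS kK qc sol1).
have J1 : J S a b q y1 = lambda1.
  have [F [H [FP HP -> H1]]] := energy _ adm1.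
  have pair1 := solution_sl_pair sol1.
  by rewrite (energy_eigen kS kK pair1.1 y1a y1b FP HP pair1) H1 mulr1.
have Jge lambda y : dirichlet_positive S a q lambda -> admissible S a b y ->
    lambda <= J S a b q y.
  move=> pos adm; have [F [H [FP HP -> H1]]] := energy _ adm.
  rewrite -[lambda]mulr1 -H1.
  case: adm => [[[yd1 _] _] ya yb _].
  apply: (dirichlet_positive_energy kS kK am qc pos _ ya yb FP HP) => t' Kt.
  by apply: xgetPex; exact: yd1.
have supP : has_sup (dirichlet_positive S a q).
  split; first exact: (dirichlet_positive_exists kS kK am qc).
  by exists lambda1 => lambda pos; rewrite -J1; exact: Jge.
split=> // y adm; rewrite J1.
apply: le_trans (_ : sup (dirichlet_positive S a q) <= _); last first.
  by apply: ge_sup => [|lambda pos]; [exact: supP.1|exact: Jge].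
have [u [v [sol ua ub va]]] := dirichlet_positive_sup kS kK am qc supP.
apply: lambda1_min; exists u; split=> //.
  exact: (sl_pair_solution kS kK am sol).
(* The slope [1] at [a] shows that [u] is not trivial. *)
apply: contrapT => u0; have Ka : kappa S a by case: (kappa_ts_kappa kS).
have {}u0 s : S s -> u s = 0 by move=> Ss; apply: contrapT => us; apply: u0; exists s.
have ud : is_delta_deriv S u a 0.
  move=> e e0; exists 1 => // s Ss _.
  rewrite !u0//; last by apply: (sigma_in tsS); exact: ltW.
  by rewrite mul0r !subr0 normr0 mulr_ge0// ltW.
have := delta_deriv_uniq kS ab Ka (sol.1 a Ka) ud.
by rewrite va => /eqP; rewrite oner_eq0.
Qed.
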